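(* Let $F$ be a probability distribution on $[0,\infty)$ with mean $\mu$, let $N$ be a non-negative integer valued random variable with distribution $\{p_n\}_{n\ge 0}$ (so $p_n=P(N=n)$), and let $G=\sum_{n=0}^{\infty}p_nF^{n*}$. Consider the relation $$(\ast)\qquad \overline{G}(x)-\Big(\sum_{n=0}^{\infty}np_n\Big)\overline{F}(x)\ \sim\ \Big\{\mu\sum_{n=0}^{\infty}n(n-1)p_n\Big\}\,F(x,x+1],\qquad x\to\infty .$$ (1) If $F\in\mathscr{S}_2$ and $E(z^N)$ is analytic at $z=1$, then $(\ast)$ holds. (2) Suppose $F\in\mathscr{L}_{\Delta(t)}$ for all $t\in(0,\infty)$, $\mu<\infty$ and $\overline{F}^2(x)=o(F(x,x+1])$ as $x\to\infty$. If the relation $(\ast)$ holds and there exists some $l\ge 2$ such that $p_l>0$, then $F\in\mathscr{S}_2$.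
   Context: For a distribution $F$ on $[0,\infty)$: $\overline{F}(x)=1-F(x)$, $\overline{F}^2(x)=(\overline{F}(x))^2$, $F(a,b]=F(b)-F(a)$; $F^{*0}$ is the unit mass at $0$ and $F^{n*}=F^{*n}$ is the $n$-fold convolution of $F$. For $t\in(0,\infty)$ put $\Delta(t)=(0,t]$ and $F(x+\Delta(t))=F(x,x+t]$. $a(x)\sim b(x)$ means $\lim_{x\to\infty}a(x)/b(x)=1$; $a(x)=o(b(x))$ means $\lim_{x\to\infty}a(x)/b(x)=0$. A relation $a(x)\sim c\,b(x)$ with a constant $c$ is read as $\lim_{x\to\infty}a(x)/b(x)=c$ (this covers the degenerate case $c=0$). Relation $(\ast)$ presupposes that the series in it are finite. ''$E(z^N)$ is analytic at $z=1$'' means that the power series $\sum_n p_nz^n$ converges in a neighbourhood of $z=1$. $F\in\mathscr{L}_{\Delta(t)}$ (local long-tailed) if $F(x+y+\Delta(t))\sim F(x+\Delta(t))$ as $x\to\infty$, uniformly in $y\in[0,1]$. $F\in\mathscr{S}_{\Delta(t)}$ (local subexponential) if $F\in\mathscr{L}_{\Delta(t)}$ and $F^{*2}(x+\Delta(t))\sim 2F(x+\Delta(t))$ as $x\to\infty$. $F\in\mathscr{S}_2$ (second order subexponential) if $F$ is a distribution on $[0,\infty)$ with finite mean $\mu$, $F\in\mathscr{S}_{\Delta(t)}$ for all $t\in(0,\infty)$, and $\overline{F^{2*}}(x)-2\overline{F}(x)\sim 2\mu F(x,x+1]$ as $x\to\infty$. *)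

(* Defs.v *)
From HB Require Import structures.
From mathcomp Require Import all_boot all_order all_algebra.
From mathcomp Require Import all_classical all_reals all_analysis.
From mathcomp Require Import measurable_realfun.

Set Implicit Arguments.
Unset Strict Implicit.
Unset Printing Implicit Defensive.

Import Order.TTheory GRing.Theory Num.Theory.
Import numFieldNormedType.Exports.

Local Open Scope classical_set_scope.
Local Open Scope ring_scope.

Section distributions.
Context {R : realType}.
Implicit Types F G : probability R R.

Definition supported_nonneg F : Prop := F `[0, +oo[%classic = 1%E.

Definition distr_fun F (x : R) : R := fine (F `]-oo, x]%classic).

Definition tail F (x : R) : R := 1 - distr_fun F x.

(* F(a, b] *)
Definition incr F (a b : R) : R := distr_fun F b - distr_fun F a.

(* For a law on the nonnegative half-line the mean always exists in [0, +oo]. *)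
Definition mean F : \bar R := (\int[F]_x x%:E)%E.

Definition addp (z : R * R) : R := z.1 + z.2.

Lemma measurable_addp : measurable_fun setT addp.
Proof. exact: measurable_funD measurable_fst measurable_snd. Qed.

HB.instance Definition _ := isMeasurableFun.Build _ _ _ _ addp measurable_addp.

Definition convolution F G : probability R R := distribution (F \x G)%E addp.

Fixpoint convolution_pow F (n : nat) : probability R R :=
  if n is n'.+1 then convolution F (convolution_pow F n') else \d_(0 : R).

End distributions.

Section random_sum.
Context {d : measure_display} {T : measurableType d} {R : realType}
  {P : probability T R}.
Variable N : {RV P >-> nat}.

Definition nat_pmf (n : nat) : R := fine (P (N @^-1` [set n])).

Lemma nat_pmf_ge0 n : 0 <= nat_pmf n.
Proof. by rewrite fine_ge0. Qed.

Definition nat_pmf_nng (n : nat) : {nonneg R} := NngNum (nat_pmf_ge0 n).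

(* A |-> \sum_(n <oo) nat_pmf n * F^{*n}(A) *)
Definition random_sum (F : probability R R) : set R -> \bar R :=
  mseries (fun n => mscale (nat_pmf_nng n) (convolution_pow F n)) 0.

HB.instance Definition _ F := Measure.on (random_sum F).

Lemma random_sum_setT F : random_sum F setT = 1%E.
Proof.
have pE n : mscale (nat_pmf_nng n) (convolution_pow F n) setT = P (N @^-1` [set n]).
  rewrite /mscale /= probability_setT mule1 /nat_pmf fineK//.
  by apply: fin_num_measure; exact: measurable_funPTI.
rewrite /random_sum /mseries (eq_eseriesr (fun n _ => pE n)).
rewrite -(probability_setT P).
have <- : \bigcup_n N @^-1` [set n] = setT.
  by apply/seteqP; split => // t _; exists (N t).
rewrite measure_bigcup//; first by apply: eq_eseriesl => n; rewrite in_setT.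
  by move=> n _; exact: measurable_funPTI.
by move=> i j _ _ [t [/= <- <-]].
Qed.

HB.instance Definition _ F :=
  Measure_isProbability.Build _ _ _ (random_sum F) (random_sum_setT F).

End random_sum.

Section asymptotics.
Context {R : realType}.

(* a(x) ~ c b(x), that is a(x) / b(x) --> c, including c = 0 (then
   it is a(x) = o(b(x))). The first conjunct is there because x / 0 = 0: the
   quotient has to be a genuine one for all large x. *)
Definition sim_cst (a : R -> R) (c : R) (b : R -> R) : Prop :=
  (\forall x \near +oo, b x != 0) /\ a x / b x @[x --> +oo] --> c.

(* The same with c = 1, uniformly in the parameter y of a, y in D. *)
Definition sim_unif (D : set R) (a : R -> R -> R) (b : R -> R) : Prop :=
  (\forall x \near +oo, b x != 0) /\
  forall e, 0 < e ->
    \forall x \near +oo, forall y, D y -> `|a y x / b x - 1| < e.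

Definition local_long_tailed (t : R) (F : probability R R) : Prop :=
  sim_unif `[0, 1]%classic
    (fun y x => incr F (x + y) (x + y + t)) (fun x => incr F x (x + t)).

Definition local_subexponential (t : R) (F : probability R R) : Prop :=
  local_long_tailed t F /\
  sim_cst (fun x => incr (convolution_pow F 2) x (x + t)) 2
    (fun x => incr F x (x + t)).

Definition second_order_subexponential (F : probability R R) : Prop :=
  [/\ supported_nonneg F,
      (mean F < +oo)%E,
      forall t, 0 < t -> local_subexponential t F
    & sim_cst (fun x => tail (convolution_pow F 2) x - 2 * tail F x)
        (2 * fine (mean F)) (fun x => incr F x (x + 1))].

(* z ranges over reals: convergence of the power series at a real z > 1 already
   gives convergence on the open complex disc of radius z. *)
Definition pgf_analytic_at1 (p : nat -> R) : Prop :=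
  \forall z \near (1 : R), cvgn (series (fun n => p n * z ^+ n)).

End asymptotics.

(* The relation presupposes that both series converge; [fine (mean F)] is the
   mean only if the latter is finite. *)
Definition second_order_relation {d : measure_display} {T : measurableType d}
    {R : realType} {P : probability T R}
    (N : {RV P >-> nat}) (F : probability R R) : Prop :=
  let s1 := series (fun n => n%:R * nat_pmf N n) in
  let s2 := series (fun n => n%:R * (n%:R - 1) * nat_pmf N n) in
  [/\ cvgn s1, cvgn s2 &
      sim_cst (fun x => tail (random_sum N F) x - limn s1 * tail F x)
        (fine (mean F) * limn s2) (fun x => incr F x (x + 1))].

(* Main.v *)
Require Import Defs.
From HB Require Import structures.
From mathcomp Require Import all_boot all_order all_algebra.
From mathcomp Require Import all_classical all_reals all_analysis.
From mathcomp Require Import measurable_realfun ring lra.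
Import Order.TTheory GRing.Theory Num.Theory.
Import numFieldNormedType.Exports.
Local Open Scope classical_set_scope.
Local Open Scope ring_scope.
Set Implicit Arguments.
Unset Strict Implicit.
Unset Printing Implicit Defensive.

(** Write D(x) for F(x, x+1], F^n for the n-th convolution power, S_n for a
    variable with law F^n, m for the mean of F, and R_n for the excess of the
    tail of F^n over n times the tail of F. Both implications rest on one
    recursion. Split the event X + S_n > x, where X has law F and is independent
    of S_n, according to whether X exceeds x, lies in the strip (x - A, x], or
    is at most x - A; subtracting n times the same splitting for n = 1 gives
    [excess_rec]:

      R_(n+1) = n R_2 + bulk of R_n + (strip of F^n - n strip of F).

    The strip of a law H is, by Fubini, the H-average of F(x - min(s, A), x].
    Near a far away point a locally long-tailed F has an asymptotically uniform
    density, equal to D(x) ([incr_uniform]), so this average is asymptotically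
    D(x) times the truncated mean of H ([cvg_strip]). Since S_n has mean n m, the
    two strips cancel as A grows. The bulk is the average of R_n(x - y) over
    y <= x - A, so bounds of R_n by multiples of D pass to R_(n+1) as soon as
    the bulk of D itself is under control ([excess_step]).

    If F is second order subexponential, then F^2(x, x+1] ~ 2 D(x) says that the
    bulk of D is asymptotic to D, and induction gives R_n ~ n (n-1) m D
    ([excess_cvg]). The same recursion yields |R_n| <= C n^2 (1+r)^n D uniformly
    in n ([excess_bound]); for small r these bounds are summable against p_n when
    the generating function is analytic at 1, and the limit may be taken under
    the sum.

    Conversely, the lower bound liminf R_n / D >= n (n-1) m already follows when
    F is locally long-tailed and its squared tail is o(D) ([excess_liminf]),
    because the bulk of D is always at least (1 - o(1)) D. Bonferroni's inequality
    R_n >= - n^2 tail^2 supplies a minorant for Fatou's lemma. The assumed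
    relation says that sum p_n R_n / D converges to exactly the sum of these lower
    bounds, so that no term with p_l > 0 can exceed its own: R_l ~ l (l-1) m D
    ([excess_limsup]). The recursion from l-1 to l then bounds R_2 / D from above
    by 2 m. Local subexponentiality comes for free, since the local masses of F^2
    minus twice those of F are differences R_2(x) - R_2(x+t) = o(D). *)

(** * Expectations of bounded measurable functions *)

Section bounded_measurable.
Context {d} {T : measurableType d} {R : realType}.
Implicit Types f g : T -> R.

Definition bounded_measurable g :=
  measurable_fun setT g /\ exists M, forall x, `|g x| <= M.

Lemma bounded_measurable_cst (c : R) : bounded_measurable (fun=> c).
Proof. by split; [exact: measurable_cst | exists `|c|]. Qed.

Lemma bounded_measurable_indic (A : set T) :
  measurable A -> bounded_measurable (\1_A : T -> R).
Proof.
move=> mA; split; first exact: measurable_indic.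
by exists 1 => x; rewrite indicE; case: (_ \in _); rewrite ?normr1 ?normr0.
Qed.

Lemma bounded_measurableD f g : bounded_measurable f -> bounded_measurable g ->
  bounded_measurable (fun x => f x + g x).
Proof.
move=> [mf [M fM]] [mg [K gK]]; split; first exact: measurable_funD.
by exists (M + K) => x; rewrite (le_trans (ler_normD _ _))// lerD.
Qed.

Lemma bounded_measurableM f g : bounded_measurable f -> bounded_measurable g ->
  bounded_measurable (fun x => f x * g x).
Proof.
move=> [mf [M fM]] [mg [K gK]]; split; first exact: measurable_funM.
by exists (M * K) => x; rewrite normrM ler_pM.
Qed.

Lemma bounded_measurableZ (c : R) g : bounded_measurable g ->
  bounded_measurable (fun x => c * g x).
Proof. by move=> bg; exact: (bounded_measurableM (bounded_measurable_cst c)). Qed.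

Lemma bounded_measurableB f g : bounded_measurable f -> bounded_measurable g ->
  bounded_measurable (fun x => f x - g x).
Proof.
move=> bf bg.
have -> : (fun x => f x - g x) = (fun x => f x + -1 * g x).
  by apply/funext => x; rewrite mulN1r.
by apply: bounded_measurableD => //; exact: bounded_measurableZ.
Qed.

Context (Q : probability T R).

Lemma bounded_measurable_integrable g : bounded_measurable g ->
  Q.-integrable setT (EFin \o g).
Proof.
move=> [mg [M gM]]; apply: measurable_bounded_integrable => //.
  by rewrite (le_lt_trans (probability_le1 Q measurableT)) ?ltry.
by exists M; split; rewrite ?num_real// => x Mx y _ /=; rewrite (le_trans (gM y))// ltW.
Qed.

Lemma Rintegral_full (A : set T) g : measurable A -> Q A = 1%E ->
  bounded_measurable g -> \int[Q]_x g x = \int[Q]_(x in A) g x.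
Proof.
move=> mA QA bg; rewrite /Rintegral; congr fine.
rewrite (@negligible_integral _ _ _ Q setT (~` A))//; first last.
- by rewrite [LHS](probability_setC Q mA) QA subee.
- exact: bounded_measurable_integrable.
- exact: measurableC.
by rewrite setTD setCK.
Qed.

(** Laws on the half-line are measures on the whole line; inequalities between
    integrands are only available on the set that carries the law. *)
Lemma le_Rintegral_full (A : set T) f g : measurable A -> Q A = 1%E ->
  bounded_measurable f -> bounded_measurable g ->
  (forall x, A x -> f x <= g x) -> \int[Q]_x f x <= \int[Q]_x g x.
Proof.
move=> mA QA bf bg fg; rewrite !(Rintegral_full mA QA)//.
by apply: le_Rintegral => //; apply: (integrableS measurableT) => //;
  exact: bounded_measurable_integrable.
Qed.

Lemma Rintegral_probability_cst (c : R) : \int[Q]_x c = c.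
Proof. by rewrite Rintegral_cst// [X in fine X](probability_setT Q) mulr1. Qed.

End bounded_measurable.

(** * Distributions on the half-line and their convolutions *)

Section tails.
Context {R : realType}.
Implicit Types (F H : probability R R) (A x : R).

Lemma tailE F x : tail F x = fine (F `]x, +oo[%classic).
Proof.
rewrite /tail /distr_fun -setCitvl probability_setC//.
by rewrite fineB ?fin_num_measure.
Qed.

Lemma tail_ge0 F x : 0 <= tail F x.
Proof. by rewrite tailE fine_ge0. Qed.

Lemma tail_le1 F x : tail F x <= 1.
Proof. by rewrite /tail lerBlDr lerDl fine_ge0. Qed.

Lemma EFin_tail F x : (tail F x)%:E = F `]x, +oo[%classic.
Proof. by rewrite tailE fineK// fin_num_measure. Qed.

Lemma tail_nonincreasing F : nonincreasing_fun (tail F).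
Proof.
move=> x y xy; rewrite -lee_fin !EFin_tail; apply: le_measure.
- by rewrite inE.
- by rewrite inE.
- by apply: subset_itvr; rewrite bnd_simp.
Qed.

Lemma incrE F x y : incr F x y = tail F x - tail F y.
Proof. by rewrite /incr /tail; ring. Qed.

Lemma incr_ge0 F x y : x <= y -> 0 <= incr F x y.
Proof. by move=> xy; rewrite incrE subr_ge0 tail_nonincreasing. Qed.

Lemma EFin_incr F x y : x <= y -> (incr F x y)%:E = F `]x, y]%classic.
Proof.
move=> xy; rewrite incrE EFinB !EFin_tail.
have -> : `]x, y]%classic = `]x, +oo[%classic `\` `]y, +oo[%classic :> set R.
  apply/seteqP; split => z /=; rewrite !in_itv/= !andbT.
    by move=> /andP[-> zy]; split => //; apply/negP; rewrite -leNgt.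
  by move=> [xz] /negP; rewrite -leNgt => ->; rewrite xz.
have Fx : (F `]x, +oo[%classic < +oo)%E by rewrite -EFin_tail ltry.
rewrite [RHS](@measureD _ _ _ F); [|done|done|exact: Fx].
congr (_ - F _)%E; apply/esym/setIidPr; by apply: subset_itvr; rewrite bnd_simp.
Qed.

Lemma supported_tail1 F x : supported_nonneg F -> x < 0 -> tail F x = 1.
Proof.
move=> F1 x0; apply/eqP; rewrite eq_le tail_le1/= -lee_fin EFin_tail -F1.
apply: le_measure; rewrite ?inE// => y /=.
by rewrite !in_itv/= !andbT; exact: lt_le_trans.
Qed.

Lemma tail_cvg0 F : tail F x @[x --> +oo] --> 0.
Proof.
pose X : {RV F >-> R} := HB.pack (@idfun R)
  (@isMeasurableFun.Build _ _ _ _ (@idfun R) (@measurable_id _ R setT)).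
have := cvg_ccdfy0 X.
by move=> /fine_cvg; apply: cvg_trans; apply: near_eq_cvg; apply: nearW => x;
  rewrite tailE.
Qed.

Lemma bounded_measurable_noninc (g : R -> R) (M : R) :
  nonincreasing_fun g -> (forall x, `|g x| <= M) -> bounded_measurable g.
Proof. by move=> gd gM; split; [exact: nonincreasing_measurable | exists M]. Qed.

Lemma bounded_measurable_nondec (g : R -> R) (M : R) :
  nondecreasing_fun g -> (forall x, `|g x| <= M) -> bounded_measurable g.
Proof. by move=> gd gM; split; [exact: nondecreasing_measurable | exists M]. Qed.

Lemma bounded_measurable_reflect (g : R -> R) x : bounded_measurable g ->
  bounded_measurable (fun y : R => g (x - y)).
Proof.
move=> [mg [M gM]]; split; last by exists M => y; exact: gM.
by apply: measurableT_comp => //; exact: measurable_funB.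
Qed.

Lemma bounded_measurable_tail H : bounded_measurable (tail H).
Proof.
apply: (@bounded_measurable_noninc _ 1) => [|y]; first exact: tail_nonincreasing.
by rewrite ger0_norm ?tail_ge0// tail_le1.
Qed.

Lemma bounded_measurable_tail_reflect H x :
  bounded_measurable (fun y : R => tail H (x - y)).
Proof.
by apply: bounded_measurable_reflect; exact: bounded_measurable_tail.
Qed.

Lemma bounded_measurable_incr H (c : R) : bounded_measurable (fun x : R => incr H x (x + c)).
Proof.
rewrite (_ : (fun _ => _) = (fun x => tail H x - tail H (x + c))); last first.
  by apply/funext => x; rewrite incrE.
apply: bounded_measurableB; first exact: bounded_measurable_tail.
apply: (@bounded_measurable_noninc _ 1) => [y z yz|y].
  by rewrite tail_nonincreasing// lerD.
by rewrite ger0_norm ?tail_ge0// tail_le1.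
Qed.

(** The truncation also cuts at 0, so that an integral of it over the whole line
    needs no restriction to the half-line. *)
Definition trunc (A s : R) : R := Num.max 0 (Num.min s A).

Lemma trunc_ge0 A s : 0 <= trunc A s.
Proof. by rewrite /trunc le_max lexx. Qed.

Lemma trunc_le A s : 0 <= A -> trunc A s <= A.
Proof. by move=> A0; rewrite /trunc ge_max A0 ge_min lexx orbT. Qed.

Lemma lt_trunc A z s : 0 <= z -> (z < trunc A s) = (z < s) && (z < A).
Proof. by move=> z0; rewrite /trunc lt_max lt_min ltNge z0. Qed.

Lemma trunc_nondecreasing A : nondecreasing_fun (trunc A).
Proof.
move=> s t st; rewrite {1}/trunc ge_max trunc_ge0/=.
by rewrite /trunc le_max le_min !ge_min st lexx !orbT.
Qed.

Lemma bounded_measurable_trunc A : 0 <= A -> bounded_measurable (trunc A).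
Proof.
move=> A0; apply: (@bounded_measurable_nondec _ A).
  exact: trunc_nondecreasing.
by move=> y; rewrite ger0_norm ?trunc_ge0// trunc_le.
Qed.

Lemma bounded_measurable_incr_trunc F (A x : R) : 0 <= A ->
  bounded_measurable (fun s : R => incr F (x - trunc A s) x).
Proof.
move=> A0; apply: (@bounded_measurable_nondec _ 1).
  by move=> s t st; rewrite !incrE lerB// tail_nonincreasing// lerB// trunc_nondecreasing.
move=> s; have xs : x - trunc A s <= x by rewrite gerBl trunc_ge0.
rewrite ger0_norm ?incr_ge0//.
by rewrite incrE (le_trans (_ : _ <= tail F (x - trunc A s))) ?tail_le1// gerBl tail_ge0.
Qed.

Definition trunc_mean H A : R := \int[H]_s trunc A s.

Lemma Rintegral_indic_gt F x : \int[F]_y \1_(`]x, +oo[%classic) y = tail F x.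
Proof. by rewrite /Rintegral integral_indic// setIT -tailE. Qed.

Lemma Rintegral_indic_le F x : \int[F]_y \1_(`]-oo, x]%classic) y = 1 - tail F x.
Proof. by rewrite /Rintegral integral_indic// setIT /tail /distr_fun; ring. Qed.

End tails.

Section convolution.
Context {R : realType}.
Implicit Types (F H : probability R R) (A x : R).

Lemma convolutionE F H B : measurable B ->
  convolution F H B = (\int[F]_y H [set s | B (y + s)%R])%E.
Proof.
move=> mB; rewrite /convolution /distribution /pushforward /= /product_measure1.
apply: eq_integral => y _ /=; congr (H _).
by apply/seteqP; split => s /=; rewrite /xsection/= inE.
Qed.

Lemma tail_convolution F H x :
  tail (convolution F H) x = \int[F]_y tail H (x - y).
Proof.
rewrite tailE convolutionE// /Rintegral; congr fine; apply: eq_integral => y _.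
rewrite EFin_tail; congr (H _); apply/seteqP; split => s /=;
  rewrite !in_itv/= !andbT; lra.
Qed.

Lemma supported_convolution F H : supported_nonneg F -> supported_nonneg H ->
  supported_nonneg (convolution F H).
Proof.
move=> F0 H0; rewrite /supported_nonneg.
apply/eqP; rewrite eq_le probability_le1//=.
have <- : (F \x H)%E (`[0, +oo[%classic `*` `[0, +oo[%classic) = 1%E.
  by rewrite /= product_measure1E// [X in (X * _)%E](F0) [X in (_ * X)%E](H0) mule1.
rewrite /convolution /distribution /pushforward.
apply: le_measure; rewrite ?inE.
- exact: measurableX.
- by rewrite -[X in measurable X]setTI; exact: measurable_addp.
- by move=> [y s] /=; rewrite /addp !in_itv/= !andbT => -[]; exact: addr_ge0.
Qed.

Lemma convolution_dirac0 F B : measurable B -> convolution F (\d_(0:R)) B = F B.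
Proof.
move=> mB; rewrite convolutionE//.
rewrite (eq_integral (fun y => (\1_B y)%:E)) ?integral_indic ?setIT// => y _.
rewrite [LHS]diracE indicE; congr (_%:R%:E); congr nat_of_bool.
by apply/idP/idP; rewrite !inE/= addr0.
Qed.

Lemma supported_dirac0 : supported_nonneg (\d_(0 : R)).
Proof.
by rewrite /supported_nonneg [LHS]diracE mem_set//= in_itv/= lexx.
Qed.

Lemma supported_convolution_pow F n : supported_nonneg F ->
  supported_nonneg (convolution_pow F n).
Proof.
move=> F0; elim: n => [|n ih] /=; first exact: supported_dirac0.
exact: supported_convolution.
Qed.

(** Fubini for the strip x - A < y <= x: there the sum y + s exceeds x exactly
    when y lies in (x - min(s, A), x]. *)
Lemma strip_convolution F H A x : 0 <= A ->
  \int[F]_y (\1_(`]x - A, x]%classic) y * tail H (x - y)) =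
  \int[H]_s incr F (x - trunc A s) x.
Proof.
move=> A0.
pose S : set (R * R) := (`]x - A, x]%classic `*` setT) `&` [set z | x < addp z].
have mS : measurable S.
  apply: measurableI; first exact: measurableX.
  rewrite (_ : [set _ | _] = addp @^-1` `]x, +oo[%classic).
    by rewrite -[X in measurable X]setTI; exact: measurable_addp.
  by apply/seteqP; split => z /=; rewrite in_itv/= andbT.
have := @indic_fubini_tonelli _ _ _ _ R F H _ mS.
rewrite indic_fubini_tonelli_FE// indic_fubini_tonelli_GE// => E.
transitivity (fine (\int[F]_y H (xsection S y))).
  rewrite /Rintegral; congr fine; apply: eq_integral => y _.
  rewrite indicE; case: (boolP (y \in _)) => yA.
    rewrite mul1r EFin_tail; congr (H _).
    apply/seteqP; split => s /=; rewrite /xsection/= in_itv/= andbT inE /S/addp/=.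
      by move: yA; rewrite inE => yA sx; split; [split|lra].
    by move=> [_]; lra.
  rewrite mul0r (_ : xsection S y = set0) ?measure0//.
  apply/seteqP; split => s //=; rewrite /xsection/= inE => -[[/= yA' _] _].
  by move: yA; rewrite notin_setE.
rewrite [X in fine X]E /Rintegral; congr fine; apply: eq_integral => s _ /=.
rewrite EFin_incr; last by rewrite gerBl trunc_ge0.
congr (F _); apply/seteqP; split => y /=; rewrite /ysection/= in_itv/= inE.
  rewrite /S /addp/= in_itv/= => -[[/andP[yA yx] _] sx].
  rewrite yx andbT ltrBlDr -ltrBlDl lt_trunc ?subr_ge0//.
  by apply/andP; split; lra.
rewrite /S /addp/= in_itv/= => /andP[+ yx].
rewrite yx andbT ltrBlDr -ltrBlDl lt_trunc ?subr_ge0// => /andP[xs xA].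
by split; [split|]; lra.
Qed.

(** The three terms correspond to the values of the summand with law F: above x,
    where the other summand is irrelevant; at most x - A, where the other one is
    left with a level of at least A to exceed; and the strip in between. *)
Lemma tail_convolution_split F H A x : supported_nonneg H -> 0 <= A ->
  tail (convolution F H) x = tail F x +
    \int[F]_y (\1_(`]-oo, x - A]%classic) y * tail H (x - y)) +
    \int[H]_s incr F (x - trunc A s) x.
Proof.
move=> H0 A0; rewrite tail_convolution -strip_convolution//.
have bt := bounded_measurable_tail_reflect H x.
have b1 : bounded_measurable (fun y => \1_(`]-oo, x - A]%classic) y * tail H (x - y)).
  by apply: bounded_measurableM => //; exact: bounded_measurable_indic.
have b2 : bounded_measurable (fun y => \1_(`]x - A, x]%classic) y * tail H (x - y)).
  by apply: bounded_measurableM => //; exact: bounded_measurable_indic.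
have b3 : bounded_measurable (\1_(`]x, +oo[%classic) : R -> R).
  exact: bounded_measurable_indic.
rewrite -(Rintegral_indic_gt F x).
rewrite -RintegralD//; [|exact: bounded_measurable_integrable..].
rewrite -RintegralD//; last 2 first.
- by apply: bounded_measurable_integrable; exact: bounded_measurableD.
- exact: bounded_measurable_integrable.
apply: eq_Rintegral => y _; rewrite !indicE !mem_setE !in_itv/= !andbT.
case: (leP y (x - A)) => yA /=.
  have yx : y <= x by lra.
  by rewrite ltNge yx /=; ring.
case: (leP y x) => yx /=; first by ring.
by rewrite supported_tail1//; [ring|lra].
Qed.

End convolution.

(** * Truncated means *)

Section trunc_mean.
Context {R : realType}.
Implicit Types (F H : probability R R) (A x : R).

Lemma min_le_trunc A s : Num.min s A <= trunc A s.
Proof. by rewrite /trunc le_max lexx orbT. Qed.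

Lemma trunc_subadd A y s : trunc A (y + s) <= trunc A y + trunc A s.
Proof.
have [y0 s0] := (trunc_ge0 A y, trunc_ge0 A s).
rewrite {1}/trunc ge_max ge_min addr_ge0//=.
have := min_le_trunc A y; have := min_le_trunc A s.
by case: (leP y A) => yA; case: (leP s A) => sA h1 h2; apply/orP;
  first (by left; lra); right; lra.
Qed.

Lemma trunc_superadd A y s : 0 <= A -> 0 <= y -> 0 <= s ->
  trunc (A / 2) y + trunc (A / 2) s <= trunc A (y + s).
Proof.
move=> A0 y0 s0; have A2 : 0 <= A / 2 by lra.
apply: le_trans (min_le_trunc A (y + s)); rewrite le_min.
have := trunc_le y A2; have := trunc_le s A2.
have tr z : 0 <= z -> trunc (A / 2) z <= z.
  by move=> z0; rewrite /trunc ge_max z0 ge_min lexx.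
by have := tr y y0; have := tr s s0 => ? ? ? ?; apply/andP; split; lra.
Qed.

Lemma trunc_le_bound A B s : A <= B -> trunc A s <= trunc B s.
Proof.
move=> AB; rewrite {1}/trunc ge_max trunc_ge0/=.
by rewrite /trunc le_max le_min !ge_min AB lexx !orbT.
Qed.

Lemma Rintegral_convolution F H (g : R -> R) : bounded_measurable g ->
  (forall x, 0 <= g x) ->
  \int[convolution F H]_x g x = \int[(F \x H)%E]_z g (addp z).
Proof.
move=> [mg _] g0; rewrite /Rintegral /convolution ge0_integral_distribution//.
exact/measurable_EFinP.
Qed.

Lemma Rintegral_fst F H (g : R -> R) : bounded_measurable g ->
  (forall x, 0 <= g x) ->
  \int[(F \x H)%E]_z g z.1 = \int[F]_x g x.
Proof.
move=> [mg _] g0; rewrite /Rintegral; congr fine.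
rewrite -(@ge0_integral_pushforward _ _ _ _ R fst measurable_fst (F \x H)%E setT
  (EFin \o g))//; last 2 first.
- exact/measurable_EFinP.
- by move=> y _ /=; rewrite lee_fin.
apply: eq_measure_integral => B mB _.
transitivity ((F \x H)%E (B `*` setT)).
  congr ((F \x H)%E _); by apply/seteqP; split => z //= [].
by rewrite [LHS]product_measure1E// [X in (_ * X)%E](probability_setT H) mule1.
Qed.

Lemma Rintegral_snd F H (g : R -> R) : bounded_measurable g ->
  (forall x, 0 <= g x) ->
  \int[(F \x H)%E]_z g z.2 = \int[H]_x g x.
Proof.
move=> [mg _] g0; rewrite /Rintegral; congr fine.
rewrite -(@ge0_integral_pushforward _ _ _ _ R snd measurable_snd (F \x H)%E setT
  (EFin \o g))//; last 2 first.
- exact/measurable_EFinP.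
- by move=> y _ /=; rewrite lee_fin.
apply: eq_measure_integral => B mB _.
transitivity ((F \x H)%E (setT `*` B)).
  congr ((F \x H)%E _); by apply/seteqP; split => z //= [].
by rewrite [LHS]product_measure1E// [X in (X * _)%E](probability_setT F) mul1e.
Qed.

Let bm2 A : 0 <= A ->
  [/\ bounded_measurable (fun z : R * R => trunc A (addp z)),
      bounded_measurable (fun z : R * R => trunc A z.1) &
      bounded_measurable (fun z : R * R => trunc A z.2)].
Proof.
move=> /bounded_measurable_trunc[mt [M tM]]; split; split;
  try (by exists M => z; exact: tM).
- exact: measurableT_comp measurable_addp.
- exact: measurableT_comp measurable_fst.
- exact: measurableT_comp measurable_snd.
Qed.

(** This bound and the next one replace the additivity of the mean by inequalities
    between bounded integrands, so that only the mean of F itself has to be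
    treated as an unbounded integral. *)
Lemma trunc_mean_convolution_le F H A : 0 <= A ->
  trunc_mean (convolution F H) A <= trunc_mean F A + trunc_mean H A.
Proof.
move=> A0; have bt := bounded_measurable_trunc A0; have [b1 b2 b3] := bm2 A0.
rewrite /trunc_mean Rintegral_convolution//; last exact: trunc_ge0.
rewrite -(Rintegral_fst F H bt (trunc_ge0 A)) -(Rintegral_snd F H bt (trunc_ge0 A)).
rewrite -RintegralD//; [|exact: bounded_measurable_integrable..].
apply: le_Rintegral => //; try exact: bounded_measurable_integrable.
  by apply: bounded_measurable_integrable; exact: bounded_measurableD.
by move=> z _; exact: trunc_subadd.
Qed.

Lemma trunc_mean_convolution_ge F H A : supported_nonneg F ->
  supported_nonneg H -> 0 <= A ->
  trunc_mean F (A / 2) + trunc_mean H (A / 2) <= trunc_mean (convolution F H) A.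
Proof.
move=> F0 H0 A0; have bt := bounded_measurable_trunc A0.
have A20 : 0 <= A / 2 by lra.
have bt2 := bounded_measurable_trunc A20; have [b1 _ _] := bm2 A0.
have [_ b2 b3] := bm2 A20.
rewrite /trunc_mean Rintegral_convolution//; last exact: trunc_ge0.
rewrite -(Rintegral_fst F H bt2 (trunc_ge0 _)) -(Rintegral_snd F H bt2 (trunc_ge0 _)).
rewrite -RintegralD//; [|exact: bounded_measurable_integrable..].
have := @le_Rintegral_full _ _ R (F \x H)%E (`[0, +oo[%classic `*` `[0, +oo[%classic).
apply.
- exact: measurableX.
- by rewrite [LHS]product_measure1E// [X in (X * _)%E](F0) [X in (_ * X)%E](H0) mule1.
- exact: bounded_measurableD.
- exact: b1.
- move=> [y s] /=; rewrite !in_itv/= !andbT => -[y0 s0].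
  exact: trunc_superadd.
Qed.

Lemma trunc_mean_nondecreasing H A B : 0 <= A -> A <= B ->
  trunc_mean H A <= trunc_mean H B.
Proof.
move=> A0 AB; have B0 := le_trans A0 AB.
apply: le_Rintegral => //.
- by apply: bounded_measurable_integrable; exact: bounded_measurable_trunc.
- by apply: bounded_measurable_integrable; exact: bounded_measurable_trunc.
by move=> s _; exact: trunc_le_bound.
Qed.

Lemma trunc_mean_dirac0 A : 0 <= A -> trunc_mean (\d_(0 : R)) A = 0.
Proof.
move=> A0; rewrite /trunc_mean /Rintegral integral_dirac//; last first.
  by apply/measurable_EFinP; have [] := bounded_measurable_trunc A0.
by rewrite diracT mul1e /trunc min_l// maxxx.
Qed.

(** The mean is an integral over the whole line, where the identity changes sign;
    monotone convergence needs the nonnegative integrand. *)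
Lemma mean_maxE F : supported_nonneg F ->
  mean F = (\int[F]_x (Num.max 0 x)%:E)%E.
Proof.
move=> F0; apply: ae_eq_integral => //.
- apply/measurable_EFinP; exact: measurable_maxr.
- exists (~` `[0, +oo[%classic); split; first exact: measurableC.
    by rewrite [LHS](probability_setC F (measurable_itv _)) [X in (_ - X)%E](F0) subee.
  move=> x /=; apply: contra_not; rewrite in_itv/= andbT => x0 _.
  by rewrite max_r.
Qed.

Lemma mean_ge0 F : supported_nonneg F -> (0 <= mean F)%E.
Proof.
move=> /mean_maxE ->; apply: integral_ge0 => x _.
by rewrite lee_fin le_max lexx.
Qed.

Lemma cvg_trunc_mean F : supported_nonneg F -> (mean F < +oo)%E ->
  trunc_mean F A @[A --> +oo] --> fine (mean F).
Proof.
move=> F0 Foo.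
have mE := mean_maxE F0.
have m0 := mean_ge0 F0.
have mfin : mean F \is a fin_num by rewrite ge0_fin_numE.
have cvn : trunc_mean F k%:R @[k --> \oo] --> fine (mean F).
  apply: fine_cvg; rewrite fineK// mE.
  rewrite (_ : (fun x => (Num.max 0 x)%:E) =
    (fun x : R => limn (fun k => (trunc k%:R x)%:E))); last first.
    apply/funext => x; apply/esym/cvg_lim => //.
    apply: cvg_near_cst.
    near=> k; rewrite /trunc min_l//; near: k; exact: nbhs_infty_ger.
  apply: cvg_monotone_convergence => //.
  - move=> k; apply/measurable_EFinP.
    by have [] := @bounded_measurable_trunc R _ (ler0n _ k).
  - by move=> k x _; rewrite lee_fin trunc_ge0.
  - by move=> x _ k l kl; rewrite lee_fin trunc_le_bound// ler_nat.
have nd : nondecreasing_seq (fun k => trunc_mean F k%:R).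
  by move=> k l kl; apply: trunc_mean_nondecreasing; rewrite ?ler_nat.
have ub k : trunc_mean F k%:R <= fine (mean F).
  rewrite -(cvg_lim _ cvn)//.
  by apply: nondecreasing_cvgn_le => //; apply/cvg_ex; exists (fine (mean F)).
apply/cvgrPdist_le => e e0.
move/cvgrPdist_le : cvn => /(_ e e0) [K _ /(_ K (leqnn _))] /= hK.
near=> A.
have A0 : 0 <= A by near: A; exact: nbhs_pinfty_ge.
have AK : K%:R <= A by near: A; exact: nbhs_pinfty_ge.
have h1 := trunc_mean_nondecreasing F (ler0n _ K) AK.
have [k Ak] : exists k : nat, A <= k%:R.
  by exists (Num.truncn A).+1; rewrite ltW// truncnS_gt.
have h2 := trunc_mean_nondecreasing F A0 Ak.
have ubk := ub k; move: hK; rewrite ler_norml => /andP[_ hK].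
by rewrite ger0_norm; lra.
Unshelve. all: by end_near. Qed.

(** Squeezed between the sum of the truncated means at A / 2 and the one at A. *)
Lemma cvg_trunc_mean_pow F n : supported_nonneg F -> (mean F < +oo)%E ->
  trunc_mean (convolution_pow F n) A @[A --> +oo] --> n%:R * fine (mean F).
Proof.
move=> F0 Foo; elim: n => [|n ih] /=.
  rewrite mul0r; apply: cvg_near_cst; near=> A.
  by rewrite [LHS]trunc_mean_dirac0//; near: A; exact: nbhs_pinfty_ge.
have cF := cvg_trunc_mean F0 Foo.
have -> : n.+1%:R * fine (mean F) = fine (mean F) + n%:R * fine (mean F).
  by rewrite -natr1; ring.
have half : (fun A : R => A / 2) @ +oo --> (+oo : set_system R).
  by apply: gt0_cvgMly; rewrite ?invr_gt0//; exact: cvg_id.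
apply: (@squeeze_cvgr _ _ _ _
   (fun A => trunc_mean F (A / 2) + trunc_mean (convolution_pow F n) (A / 2))
   (fun A => trunc_mean F A + trunc_mean (convolution_pow F n) A)).
- near=> A; have A0 : 0 <= A by near: A; exact: nbhs_pinfty_ge.
  rewrite trunc_mean_convolution_le// andbT trunc_mean_convolution_ge//.
  exact: supported_convolution_pow.
- by apply: cvgD; [exact: (cvg_comp _ _ half cF)|exact: (cvg_comp _ _ half ih)].
- exact: cvgD.
Unshelve. all: by end_near. Qed.

End trunc_mean.

(** * Asymptotic lower bounds and Fatou's lemma for series *)

Section asymptotic_lower_bounds.
Context {R : realType}.
Implicit Types (u v : R -> R) (c : R).

(** The limit inferior of u at +oo is at least c. *)
Definition asy_ge (u : R -> R) (c : R) :=
  forall e, 0 < e -> \forall x \near +oo, c - e <= u x.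

Lemma cvg_asy_ge u c : u x @[x --> +oo] --> c -> asy_ge u c.
Proof.
move=> /cvgrPdist_le h e e0; apply: filterS (h e e0) => x.
by rewrite ler_norml => /andP[_]; lra.
Qed.

Lemma asy_ge_cvg u c : asy_ge u c -> asy_ge (fun x => - u x) (- c) ->
  u x @[x --> +oo] --> c.
Proof.
move=> h1 h2; apply/cvgrPdist_le => e e0.
apply: filterS2 (h1 e e0) (h2 e e0) => x a b.
by rewrite ler_norml; apply/andP; split; lra.
Qed.

Lemma asy_geD u v c c' : asy_ge u c -> asy_ge v c' ->
  asy_ge (fun x => u x + v x) (c + c').
Proof.
move=> h1 h2 e e0; have e2 : 0 < e / 2 by lra.
by apply: filterS2 (h1 _ e2) (h2 _ e2) => x a b; lra.
Qed.

Lemma asy_geZ u (k c : R) : 0 <= k -> asy_ge u c ->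
  asy_ge (fun x => k * u x) (k * c).
Proof.
move=> k0 h e e0.
have e1 : 0 < e / (k + 1) by rewrite divr_gt0//; lra.
apply: filterS (h _ e1) => x a; apply: le_trans (ler_wpM2l k0 a).
rewrite mulrBr lerD2l lerN2 mulrCA.
by apply: ler_piMr; [exact: ltW | rewrite ler_pdivrMr; lra].
Qed.

Lemma asy_ge_near u v c : (\forall x \near +oo, u x <= v x) -> asy_ge u c ->
  asy_ge v c.
Proof. by move=> uv h e e0; apply: filterS2 uv (h e e0) => x a b; lra. Qed.

(** Fatou's lemma for series, with a summable minorant - b: finitely many terms
    nearly reach their lower limits, and the others lose at most a remainder of
    the series of b. *)
Lemma series_liminf (v : R -> nat -> R) (c b : nat -> R) (V : R -> R) (l : R) :
  (forall n, asy_ge (v ^~ n) (c n)) ->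
  (forall n, 0 <= b n) ->
  (\forall x \near +oo, forall n, - b n <= v x n) ->
  cvgn (series b) -> series c @ \oo --> l ->
  (forall x, series (v x) @ \oo --> V x) ->
  asy_ge V l.
Proof.
move=> vc b0 vb cb cc cv e e0; have e4 : 0 < e / 4 by lra.
have cM : \forall M \near \oo, `|l - series c M| <= e / 4 /\
    `|limn (series b) - series b M| <= e / 4.
  by apply: filterI; [move/cvgrPdist_le : cc|move/cvgrPdist_le : cb]; exact.
have [M [cM1 cM2]] := filter_ex cM.
have eM : 0 < e / 4 / M.+1%:R by rewrite divr_gt0.
have vM : \forall x \near +oo, forall n : 'I_M, c n - e / 4 / M.+1%:R <= v x n.
  by apply: filter_forall => n; exact: vc.
near=> x.
have vMx : forall n : 'I_M, c n - e / 4 / M.+1%:R <= v x n by near: x.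
have vbx : forall n, - b n <= v x n by near: x.
have h1 : series c M - e / 4 <= series (v x) M.
  rewrite !seriesEord/=.
  apply: (@le_trans _ _ (\sum_(k < M) (c k - e / 4 / M.+1%:R))); last exact: ler_sum.
  rewrite sumrB sumr_const card_ord lerD2l lerN2 -[X in X <= _]mulr_natr.
  rewrite -[X in X <= _]mulrA -[X in _ <= X]mulr1 ler_pM2l//.
  by rewrite ler_pdivrMl// mulr1 ler_nat.
rewrite -(cvg_lim _ (cv x))//.
apply: limr_ge; first by apply/cvg_ex; exists (V x).
near=> m.
have Mm : (M <= m)%N by near: m; exact: nbhs_infty_ge.
have h2 : series (v x) m - series (v x) M >= - (series b m - series b M).
  rewrite !sub_series_geq// -sumrN; exact: ler_sum.
have h3 : series b m <= limn (series b).
  by apply: nondecreasing_cvgn_le => //; exact: nondecreasing_series.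
move: cM1 cM2; rewrite !ler_norml => /andP[? ?] /andP[? ?]; lra.
Unshelve. all: by end_near. Qed.

End asymptotic_lower_bounds.

(** * Increments of a locally long-tailed distribution *)

Section local_increments.
Context {R : realType}.

Lemma near_pinfty_ge (c : R) : \forall x \near +oo, c <= x.
Proof. by apply: nbhs_pinfty_ge; exact: num_real. Qed.

Lemma cvg_shift_pinfty (c : R) : x + c @[x --> +oo] --> (+oo : set_system R).
Proof.
apply/cvgryPge => A; near=> x; rewrite -lerBlDr.
by near: x; exact: near_pinfty_ge.
Unshelve. all: by end_near. Qed.

Lemma near_shift_pinfty (c : R) (S : R -> Prop) :
  (\forall x \near +oo, S x) -> \forall x \near +oo, S (x + c).
Proof. by move=> hS; exact: (cvg_shift_pinfty c hS). Qed.

Context (F : probability R R).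
Hypothesis long : forall t : R, 0 < t -> local_long_tailed t F.

Local Notation D x := (incr F x (x + 1)).

Lemma incr_gt0_near (t : R) : 0 < t -> \forall x \near +oo, 0 < incr F x (x + t).
Proof.
move=> t0; have [h _] := long t0; apply: filterS h => x h.
by rewrite lt_neqAle eq_sym h incr_ge0// lerDl ltW.
Qed.

Lemma cvg_incr_shiftr (t y : R) : 0 < t -> 0 <= y <= 1 ->
  incr F (x + y) (x + y + t) / incr F x (x + t) @[x --> +oo] --> (1 : R).
Proof.
move=> t0 y01; have [_ h] := long t0; apply/cvgrPdist_lt => e e0.
apply: filterS (h e e0) => x hx; rewrite distrC.
by apply: hx; rewrite /= in_itv.
Qed.

Lemma cvg_incr_shiftl (t y : R) : 0 < t -> 0 <= y <= 1 ->
  incr F (x - y) (x - y + t) / incr F x (x + t) @[x --> +oo] --> (1 : R).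
Proof.
move=> t0 y01; rewrite -[X in _ --> X]invr1.
have := cvg_comp _ _ (cvg_shift_pinfty (- y)) (cvg_incr_shiftr t0 y01).
move/(cvgV (oner_neq0 _)); apply: cvg_trans; apply: near_eq_cvg.
by apply: nearW => x /=; rewrite invf_div subrK.
Qed.

(** The hypothesis controls shifts by at most 1; longer ones are made of j steps. *)
Lemma cvg_incr_steps (t h : R) j : 0 < t -> 0 <= h <= 1 ->
  incr F (x - j%:R * h) (x - j%:R * h + t) / incr F x (x + t) @[x --> +oo] --> (1 : R).
Proof.
move=> t0 h01; elim: j => [|j ih].
  apply: cvg_near_cst; apply: filterS (incr_gt0_near t0) => x x0.
  by rewrite mul0r subr0 divff// gt_eqF.
have := cvg_comp _ _ (cvg_shift_pinfty (- (j%:R * h))) (cvg_incr_shiftl t0 h01).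
move=> /cvgM /(_ ih); rewrite mulr1; apply: cvg_trans; apply: near_eq_cvg.
apply: filterS (near_shift_pinfty (- (j%:R * h)) (incr_gt0_near t0)) => x x0 /=.
rewrite mulrA divfK ?gt_eqF//.
have -> : x - j%:R * h - h = x - j.+1%:R * h by rewrite -natr1; ring.
by [].
Qed.

Lemma incr_telescope (a : nat -> R) n :
  incr F (a 0%N) (a n) = \sum_(j < n) incr F (a j) (a j.+1).
Proof.
elim: n => [|n ih]; first by rewrite big_ord0 incrE subrr.
by rewrite big_ord_recr/= -ih !incrE; ring.
Qed.

(** A unit interval is cut into k+1 pieces of asymptotically equal mass. *)
Lemma cvg_incr_fraction k : let h := k.+1%:R^-1 : R in
  incr F x (x + h) / D x @[x --> +oo] --> h.
Proof.
move=> h; have h0 : 0 < h by rewrite invr_gt0.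
have h1 : h <= 1 by rewrite invf_le1// ler1n.
have kh : k.+1%:R * h = 1 by rewrite mulfV// pnatr_eq0.
have : \sum_(j < k.+1) (incr F (x + j%:R * h) (x + j%:R * h + h) / incr F x (x + h))
   @[x --> +oo] --> (\sum_(j < k.+1) 1 : R).
  apply: cvg_big => [|j _]; [exact: add_continuous|]; apply: cvg_incr_shiftr => //.
  apply/andP; split; first by rewrite mulr_ge0// ltW.
  by rewrite -[X in _ <= X]kh ler_pM2r// ler_nat ltnW.
rewrite sumr_const card_ord -[X in _ --> X]invrK.
move/(cvgV (invr_neq0 (lt0r_neq0 h0))); rewrite invrK.
apply: cvg_trans; apply: near_eq_cvg; apply: nearW => x.
rewrite /= -mulr_suml invf_div; congr (_ / _).
have -> : D x = incr F (x + 0%:R * h) (x + k.+1%:R * h).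
  by rewrite kh mul0r addr0.
rewrite (incr_telescope (fun j : nat => x + j%:R * h)).
by apply: eq_bigr => j _; congr incr; rewrite -natr1; ring.
Qed.

Lemma cvg_incr_rational k m : let h := k.+1%:R^-1 : R in
  incr F (x - m%:R * h) x / D x @[x --> +oo] --> m%:R * h.
Proof.
move=> h; have h0 : 0 < h by rewrite invr_gt0.
have h1 : 0 <= h <= 1 by rewrite ltW//= invf_le1// ler1n.
have : (\sum_(j < m) (incr F (x - j.+1%:R * h) (x - j.+1%:R * h + h) /
      incr F x (x + h))) * (incr F x (x + h) / D x) @[x --> +oo] --> ((\sum_(j < m) 1) * h : R).
  apply: cvgM; last exact: cvg_incr_fraction.
  by apply: cvg_big => [|j _]; [exact: add_continuous|]; exact: cvg_incr_steps.
rewrite sumr_const card_ord; apply: cvg_trans; apply: near_eq_cvg.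
apply: filterS (incr_gt0_near h0) => x x0.
rewrite -mulr_suml mulrA divfK ?gt_eqF//; congr (_ / _).
have := incr_telescope (fun j : nat => x - (m%:R - j%:R) * h) m.
rewrite /= !subr0 subrr mul0r subr0 => ->.
rewrite (reindex_inj rev_ord_inj)/=; apply: eq_bigr => j _.
have -> : (m - j.+1).+1 = (m - j)%N by rewrite subnSK.
have E2 : (m - j)%:R = m%:R - j%:R :> R by rewrite natrB// ltnW.
have E3 : j.+1%:R = j%:R + 1 :> R by rewrite natr1.
rewrite E2 E3; congr incr; ring.
Qed.

(** Monotonicity in t upgrades the limits at the rational points to a limit
    that is uniform in t. *)
Lemma incr_uniform (A e : R) : 0 <= A -> 0 < e ->
  \forall x \near +oo, forall t, 0 <= t <= A ->
    `|incr F (x - t) x - t * D x| <= e * D x.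
Proof.
move=> A0 e0.
(* a mesh h <= e / 2, and enough mesh points to cover [0, A] *)
pose k := Num.truncn (2 / e); pose h : R := k.+1%:R^-1.
have h0 : 0 < h by rewrite invr_gt0.
have he : h <= e / 2.
  by rewrite -[e / 2]invrK lef_pV2 ?posrE ?invr_gt0 ?divr_gt0// invf_div ltW// truncnS_gt.
pose M := (Num.truncn (A * k.+1%:R)).+1.
have : \forall x \near +oo, forall j : 'I_M.+1,
    `|j%:R * h - incr F (x - j%:R * h) x / D x| <= e / 2.
  apply: filter_forall => j.
  have /cvgrPdist_le := @cvg_incr_rational k j; apply; lra.
move=> H; near=> x => t /andP[t0 tA].
have Dx : 0 < D x by near: x; exact: incr_gt0_near.
have Hx : forall j : nat, (j <= M)%N ->
    `|j%:R * h * D x - incr F (x - j%:R * h) x| <= e / 2 * D x.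
  move=> j jM.
  have : forall j : 'I_M.+1,
    `|j%:R * h - incr F (x - j%:R * h) x / D x| <= e / 2 by near: x.
  move=> /(_ (Ordinal (jM : (j < M.+1)%N)))/=.
  rewrite -(ler_pM2r Dx) -{2}(gtr0_norm Dx) -normrM mulrBl.
  by rewrite divfK// gt_eqF.
have tk : 0 <= t * k.+1%:R by rewrite mulr_ge0.
have /andP[j1 j2] := truncn_itv tk.
set j := Num.truncn (t * k.+1%:R) in j1 j2.
have jM : (j < M)%N.
  by rewrite ltnS le_truncn// ler_wpM2r.
have := Hx j (ltnW jM); have := Hx j.+1 jM.
have jh1 : j%:R * h <= t by rewrite ler_pdivrMr.
have jh2 : t <= j.+1%:R * h by rewrite ler_pdivlMr// ltW.
have jh : j.+1%:R * h = j%:R * h + h by rewrite -natr1; ring.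
have m1 : incr F (x - j%:R * h) x <= incr F (x - t) x.
  by rewrite !incrE lerB// tail_nonincreasing// lerB.
have m2 : incr F (x - t) x <= incr F (x - j.+1%:R * h) x.
  by rewrite !incrE lerB// tail_nonincreasing// lerB.
rewrite !ler_norml => /andP[a1 a2] /andP[b1 b2].
have c1 : j.+1%:R * h * D x <= (t + e / 2) * D x by rewrite ler_pM2r//; lra.
have c2 : (t - e / 2) * D x <= j%:R * h * D x by rewrite ler_pM2r//; lra.
by apply/andP; split; lra.
Unshelve. all: by end_near. Qed.

End local_increments.

(** * The excess of a convolution tail *)

Section excess.
Context {R : realType}.
Variable F : probability R R.
Implicit Types (H : probability R R) (A x : R) (f g : R -> R).

Local Notation D x := (incr F x (x + 1)).

(** The probability that a sum of independent variables with laws F and H exceeds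
    x while the F-summand lies in (x - A, x], by [strip_convolution]. *)
Definition strip H A x : R := \int[H]_s incr F (x - trunc A s) x.

(** For g = tail H, the probability that the sum exceeds x while the F-summand
    stays below x - A; then only the values of g on [A, +oo) enter. *)
Definition bulk A (g : R -> R) x : R :=
  \int[F]_y (\1_(`]-oo, x - A]%classic) y * g (x - y)).

Definition excess n x : R := tail (convolution_pow F n) x - n%:R * tail F x.

Lemma bounded_measurable_excess n : bounded_measurable (excess n).
Proof.
apply: bounded_measurableB; first exact: bounded_measurable_tail.
by apply: bounded_measurableZ; exact: bounded_measurable_tail.
Qed.

Lemma bounded_measurable_bulk A g x : bounded_measurable g ->
  bounded_measurable (fun y : R => \1_(`]-oo, x - A]%classic) y * g (x - y)).
Proof.
move=> bg; apply: bounded_measurableM; first exact: bounded_measurable_indic.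
exact: bounded_measurable_reflect.
Qed.

Lemma bulkB A f g x : bounded_measurable f -> bounded_measurable g ->
  bulk A (fun u => f u - g u) x = bulk A f x - bulk A g x.
Proof.
move=> bf bg; rewrite /bulk -RintegralB//;
  [|apply: bounded_measurable_integrable; exact: bounded_measurable_bulk..].
by apply: eq_Rintegral => y _; rewrite mulrBr.
Qed.

Lemma bulkZ A (c : R) g x : bounded_measurable g ->
  bulk A (fun u => c * g u) x = c * bulk A g x.
Proof.
move=> bg; rewrite /bulk -RintegralZl//;
  last by apply: bounded_measurable_integrable; exact: bounded_measurable_bulk.
by apply: eq_Rintegral => y _; rewrite mulrCA.
Qed.

Lemma le_bulk A f g x : bounded_measurable f -> bounded_measurable g ->
  (forall u, A <= u -> f u <= g u) -> bulk A f x <= bulk A g x.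
Proof.
move=> bf bg fg; apply: le_Rintegral => //;
  try (by apply: bounded_measurable_integrable; exact: bounded_measurable_bulk).
move=> y _; rewrite indicE mem_setE in_itv/=.
by case: (leP y (x - A)) => yA /=; rewrite ?mul0r// !mul1r fg//; lra.
Qed.

Lemma strip_ge0 H A x : 0 <= strip H A x.
Proof.
by apply: Rintegral_ge0 => s _; rewrite incr_ge0// gerBl trunc_ge0.
Qed.

Lemma strip_le H A x : 0 <= A -> strip H A x <= incr F (x - A) x.
Proof.
move=> A0; rewrite -(Rintegral_probability_cst H (incr F (x - A) x)).
apply: le_Rintegral => //.
- by apply: bounded_measurable_integrable; exact: bounded_measurable_incr_trunc.
- by apply: bounded_measurable_integrable; exact: bounded_measurable_cst.
by move=> s _; rewrite !incrE lerB// tail_nonincreasing// lerB// trunc_le.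
Qed.

Lemma excess0 x : 0 <= x -> excess 0 x = 0.
Proof.
move=> x0; rewrite /excess mul0r subr0 /= tailE [X in fine X]diracE memNset//=.
by rewrite in_itv/= andbT; apply/negP; rewrite -leNgt.
Qed.

Lemma tail_pow1 x : tail (convolution_pow F 1) x = tail F x.
Proof. by rewrite !tailE; congr fine; exact: convolution_dirac0. Qed.

Hypothesis F0 : supported_nonneg F.

Lemma tail_powS n A x : 0 <= A -> tail (convolution_pow F n.+1) x =
  tail F x + bulk A (tail (convolution_pow F n)) x + strip (convolution_pow F n) A x.
Proof.
move=> A0; rewrite -[LHS]/(tail (convolution F (convolution_pow F n)) x).
by rewrite (@tail_convolution_split _ F _ A)//; exact: supported_convolution_pow.
Qed.

Lemma tail_pow2 A x : 0 <= A -> tail (convolution_pow F 2) x =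
  tail F x + bulk A (tail F) x + strip (convolution_pow F 1) A x.
Proof.
move=> A0; rewrite (tail_powS 1 x A0).
by rewrite (_ : tail (convolution_pow F 1) = tail F)//; apply/funext => y; exact: tail_pow1.
Qed.

(** Comparing the decompositions of F^(n+1) and of F^2 removes the linear part
    of the tail of F^n from the bulk. *)
Lemma excess_rec n A x : 0 <= A ->
  excess n.+1 x = n%:R * excess 2 x + bulk A (excess n) x +
    (strip (convolution_pow F n) A x - n%:R * strip (convolution_pow F 1) A x).
Proof.
move=> A0; have bt := bounded_measurable_tail.
rewrite /excess (tail_powS n x A0) (tail_pow2 x A0).
rewrite bulkB ?bulkZ//; last exact: bounded_measurableZ.
by rewrite -natr1; ring.
Qed.

(** The bulk of D differs from the local mass of F^2 only by strips, so that its
    asymptotics needs no separate analysis. *)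
Lemma bulk_incr A x : 0 <= A ->
  bulk A (fun u => D u) x = incr (convolution_pow F 2) x (x + 1) - D x -
    strip (convolution_pow F 1) A x + strip (convolution_pow F 1) (A + 1) (x + 1).
Proof.
move=> A0; have A1 : 0 <= A + 1 by lra.
have bt := bounded_measurable_tail.
rewrite !incrE (tail_pow2 x A0) (tail_pow2 (x + 1) A1).
rewrite (_ : bulk A (fun u => D u) x = bulk A (tail F) x - bulk (A + 1) (tail F) (x + 1));
  first by ring.
rewrite /bulk -RintegralB//;
  [|apply: bounded_measurable_integrable; exact: bounded_measurable_bulk..].
apply: eq_Rintegral => y _; rewrite incrE.
have -> : x + 1 - (A + 1) = x - A by ring.
have -> : x + 1 - y = x - y + 1 by ring.
by rewrite mulrBr.
Qed.

Hypothesis long : forall t : R, 0 < t -> local_long_tailed t F.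

Let D_gt0 : \forall x \near +oo, 0 < D x.
Proof. exact: incr_gt0_near. Qed.

(** The approximation F(x - t, x] = t D(x) holds uniformly for t in [0, A], hence
    under the integral. *)
Lemma cvg_strip H A : 0 <= A ->
  strip H A x / D x @[x --> +oo] --> trunc_mean H A.
Proof.
move=> A0; apply/cvgrPdist_le => e e0; near=> x.
have Dx : 0 < D x by near: x.
have bt := bounded_measurable_trunc A0.
have bi := bounded_measurable_incr_trunc F x A0.
have Hx : forall t, 0 <= t <= A -> `|incr F (x - t) x - t * D x| <= e * D x.
  by near: x; exact: incr_uniform.
rewrite -(ler_pM2r Dx) -{2}(gtr0_norm Dx) -normrM mulrBl divfK ?gt_eqF//.
rewrite -RintegralZr//; last exact: bounded_measurable_integrable.
have bt' : bounded_measurable (fun s => trunc A s * D x).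
  by apply: bounded_measurableM => //; exact: bounded_measurable_cst.
rewrite -RintegralB//; [|exact: bounded_measurable_integrable..].
have bd := bounded_measurableB bt' bi.
apply: le_trans; first by apply: le_normr_Rintegral => //; exact: bounded_measurable_integrable.
rewrite -(Rintegral_probability_cst H (e * D x)).
apply: le_Rintegral => //.
- apply: integrable_norm; exact: bounded_measurable_integrable.
- by apply: bounded_measurable_integrable; exact: bounded_measurable_cst.
by move=> s _; rewrite distrC; apply: Hx; rewrite trunc_ge0 trunc_le.
Unshelve. all: by end_near. Qed.

(** Both ends of (x - y, x - y + 1] are compared with x + 1, from where all
    relevant points lie to the left. *)
Lemma incr_shift_uniform (B e : R) : 0 <= B -> 0 < e ->
  \forall x \near +oo, forall y, 0 <= y <= B -> (1 - e) * D x <= D (x - y).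
Proof.
move=> B0 e0; pose e' := Num.min (e / 8) (1 / 4).
have e'0 : 0 < e' by rewrite lt_min; apply/andP; split; lra.
have e'1 : e' <= e / 8 by rewrite ge_min lexx.
have e'2 : e' <= 1 / 4 by rewrite ge_min lexx orbT.
have B1 : 0 <= B + 1 by lra.
have := near_shift_pinfty 1 (incr_uniform long B1 e'0).
have := near_shift_pinfty 1 D_gt0.
apply: filterS2 => x Dx1 Hx y /andP[y0 yB].
have key z : 0 <= z <= B ->
    `|D (x - z) - D (x + 1)| <= 2 * e' * D (x + 1).
  move=> /andP[z0 zB].
  have z1 : 0 <= z <= B + 1 by apply/andP; split; lra.
  have z2 : 0 <= z + 1 <= B + 1 by apply/andP; split; lra.
  have := Hx z z1; have := Hx (z + 1) z2.
  have -> : x + 1 - (z + 1) = x - z by ring.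
  have -> : x + 1 - z = x - z + 1 by ring.
  rewrite !incrE !ler_norml => /andP[? ?] /andP[? ?].
  by apply/andP; split; lra.
have := key y; rewrite y0 yB => /(_ isT).
have := key 0; rewrite lexx B0 subr0 => /(_ isT).
rewrite !ler_norml => /andP[a1 a2] /andP[b1 b2].
have c1 : 0 <= (1 / 4 - e') * D (x + 1) by apply: mulr_ge0; [lra | exact: ltW].
have c3 : 0 <= D x by rewrite incr_ge0// lerDl.
have c2 : e' * (2 * D x) <= e / 8 * (2 * D x) by rewrite ler_wpM2r//; lra.
have c4 : e' * D (x + 1) <= e' * (2 * D x) by apply: (ler_wpM2l (ltW e'0)); lra.
lra.
Qed.

(** The mass of F near 0 alone already makes the bulk of the local masses at
    least asymptotically one local mass. *)
Lemma bulk_incr_ge A (e : R) : 0 < e ->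
  \forall x \near +oo, 1 - e <= bulk A (fun u => D u) x / D x.
Proof.
move=> e0; pose e' := Num.min (e / 2) (1 / 2).
have e'0 : 0 < e' by rewrite lt_min; apply/andP; split; lra.
have e'1 : e' <= e / 2 by rewrite ge_min lexx.
have e'2 : e' <= 1 / 2 by rewrite ge_min lexx orbT.
have [B [B0 tB]] : exists B, 0 <= B /\ tail F B <= e'.
  have : \forall B \near +oo, 0 <= B /\ tail F B <= e'.
    apply: filterI; first exact: near_pinfty_ge.
    have /cvgrPdist_le/(_ _ e'0) := @tail_cvg0 _ F; apply: filterS => B.
    by rewrite sub0r normrN ger0_norm ?tail_ge0.
  by move=> /filter_ex[B]; exists B.
near=> x.
have Dx : 0 < D x by near: x.
have xB : B + A <= x by near: x; exact: near_pinfty_ge.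
have Hx : forall y, 0 <= y <= B -> (1 - e') * D x <= D (x - y).
  by near: x; exact: incr_shift_uniform.
rewrite ler_pdivlMr//.
apply: (@le_trans _ _ ((1 - e') * D x * (1 - tail F B))).
  have : (1 - e') * D x * tail F B <= (1 - e') * D x * e'.
    by apply: ler_wpM2l => //; apply: mulr_ge0; [lra | exact: ltW].
  have : 0 <= e' * e' * D x by apply: mulr_ge0 (ltW Dx); apply: mulr_ge0; exact: ltW.
  have : e' * D x <= e / 2 * D x by rewrite ler_pM2r.
  lra.
rewrite -Rintegral_indic_le.
have bi : bounded_measurable (\1_(`]-oo, B]%classic) : R -> R).
  exact: bounded_measurable_indic.
rewrite -RintegralZl//; last exact: bounded_measurable_integrable.
apply: (le_Rintegral_full (measurable_itv `[0, +oo[) F0).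
- exact: bounded_measurableZ.
- exact: (bounded_measurable_bulk A x (bounded_measurable_incr F 1)).
move=> y /=; rewrite in_itv/= andbT => y0; rewrite !indicE !mem_setE !in_itv/=.
have Dxy : 0 <= D (x - y) by rewrite incr_ge0// lerDl.
case: (leP y B) => yB /=.
  have -> : y <= x - A by lra.
  by rewrite mulr1 mul1r Hx// y0.
by rewrite mulr0 mulr_ge0//; case: (_ <= _).
Unshelve. all: by end_near. Qed.

Hypothesis Foo : (mean F < +oo)%E.

(** The strips contribute a difference of truncated means that vanishes as A
    grows; only the bulk transports the bound from n to n+1. The factor s serves
    to treat lower bounds (s = 1) and upper bounds (s = -1) at once. The second
    premise isolates what is needed of F: the bulk of c' D is not much below c' D
    for some c' just below c. For c > 0 this only asks for a lower bound on the
    bulk of D. *)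
Lemma excess_step (s c : R) n :
  asy_ge (fun x => s * excess n x / D x) c ->
  (forall e, 0 < e -> exists c', [/\ c - e <= c', c' < c &
     \forall A \near +oo, \forall x \near +oo,
       c' - e <= c' * (bulk A (fun u => D u) x / D x)]) ->
  asy_ge (fun x => s * (excess n.+1 x - n%:R * excess 2 x) / D x) c.
Proof.
move=> hc hmid e e0; have e80 : 0 < e / 8 by lra.
have [c' [cc' c'c Hmid]] := hmid _ e80.
have d0 : 0 < c - c' by lra.
have bD := bounded_measurable_incr F 1.
have [A0 hA0] : exists A0 : R, forall u, A0 <= u -> c' * D u <= s * excess n u.
  have [A0 [_ hA0]] := filterI D_gt0 (hc _ d0).
  exists (A0 + 1) => u uA; have [/= |Du] := hA0 u; first by lra.
  by rewrite (_ : c - (c - c') = c') ?ler_pdivlMr//; ring.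
have tm0 : s * (trunc_mean (convolution_pow F n) A -
     n%:R * trunc_mean (convolution_pow F 1) A) @[A --> +oo] --> (0 : R).
  rewrite (_ : 0 = s * (n%:R * fine (mean F) - n%:R * (1%:R * fine (mean F)))).
    apply: cvgMl_tmp; apply: cvgB; first exact: cvg_trunc_mean_pow.
    by apply: cvgMl_tmp; exact: cvg_trunc_mean_pow.
  by ring.
have : \forall A \near +oo, [/\ 0 <= A, A0 <= A, (\forall x \near +oo,
       c' - e / 8 <= c' * (bulk A (fun u => D u) x / D x)) &
       `|s * (trunc_mean (convolution_pow F n) A -
     n%:R * trunc_mean (convolution_pow F 1) A)| <= e / 8].
  near=> A; split; try (by near: A; exact: near_pinfty_ge); first by near: A.
  by rewrite -normrN -sub0r; near: A; move/cvgrPdist_le : tm0; exact.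
move=> /filter_ex[A [Ap AA0 HA tmA]].
have cs : s * (strip (convolution_pow F n) A x / D x -
     n%:R * (strip (convolution_pow F 1) A x / D x)) @[x --> +oo] -->
     s * (trunc_mean (convolution_pow F n) A -
     n%:R * trunc_mean (convolution_pow F 1) A).
  apply: cvgMl_tmp; apply: cvgB; first exact: cvg_strip.
  by apply: cvgMl_tmp; exact: cvg_strip.
move/cvgrPdist_le : cs => /(_ _ e80) cs.
near=> x.
have Dx : 0 < D x by near: x.
have h1 : c' - e / 8 <= c' * (bulk A (fun u => D u) x / D x) by near: x.
have h2 : `|s * (trunc_mean (convolution_pow F n) A -
     n%:R * trunc_mean (convolution_pow F 1) A) -
     s * (strip (convolution_pow F n) A x / D x -
     n%:R * (strip (convolution_pow F 1) A x / D x))| <= e / 8 by near: x.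
have h3 : c' * bulk A (fun u => D u) x <= s * bulk A (excess n) x.
  have be := bounded_measurable_excess n.
  rewrite -!bulkZ//; apply: le_bulk.
  - exact: bounded_measurableZ.
  - exact: bounded_measurableZ.
  - by move=> u Au; apply: hA0; exact: le_trans Au.
have h4 : c' * (bulk A (fun u => D u) x / D x) <= s * bulk A (excess n) x / D x.
  by rewrite mulrA ler_pM2r// invr_gt0.
rewrite (excess_rec n x Ap).
have -> : s * (n%:R * excess 2 x + bulk A (excess n) x +
   (strip (convolution_pow F n) A x - n%:R * strip (convolution_pow F 1) A x) -
   n%:R * excess 2 x) / D x = s * bulk A (excess n) x / D x +
   s * (strip (convolution_pow F n) A x / D x -
     n%:R * (strip (convolution_pow F 1) A x / D x)) by ring.
move: tmA h2; rewrite !ler_norml => /andP[? ?] /andP[? ?]; lra.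
Unshelve. all: by end_near. Qed.

End excess.

(** * The tail of a random sum *)

Section random_sum_tail.
Context d (T : measurableType d) (R : realType) (P : probability T R).
Variables (N : {RV P >-> nat}) (F : probability R R).
Local Notation p := (nat_pmf N).

Lemma cvg_series_tail_random_sum x :
  series (fun n => p n * tail (convolution_pow F n) x) @ \oo -->
  tail (random_sum N F) x.
Proof.
have E : (tail (random_sum N F) x)%:E =
    (\sum_(0 <= n <oo) (p n * tail (convolution_pow F n) x)%:E)%E.
  rewrite EFin_tail; transitivity (\sum_(0 <= n <oo)
    mscale (nat_pmf_nng N n) (convolution_pow F n) `]x, +oo[%classic)%E => //.
  by apply: eq_eseriesr => n _; rewrite EFinM EFin_tail.
have cv : (\sum_(0 <= n < m) (p n * tail (convolution_pow F n) x)%:E)%E @[m --> \oo] -->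
    (tail (random_sum N F) x)%:E.
  rewrite E; apply: is_cvg_nneseries => n _ _.
  by rewrite lee_fin mulr_ge0 ?nat_pmf_ge0 ?tail_ge0.
move/fine_cvg : cv; apply: cvg_trans; apply: near_eq_cvg; apply: nearW => m /=.
by rewrite sumEFin.
Qed.

(** Weighting each convolution power by p n turns the centring by n * tail F
    into the centring by E(N) * tail F. *)
Lemma cvg_series_excess x : cvgn (series (fun n => n%:R * p n)) ->
  series (fun n => p n * excess F n x) @ \oo -->
  tail (random_sum N F) x - limn (series (fun n => n%:R * p n)) * tail F x.
Proof.
move=> c1.
have -> : series (fun n => p n * excess F n x) =
   series (fun n => p n * tail (convolution_pow F n) x) -
   (fun m => series (fun n => n%:R * p n) m * tail F x).
  apply/funext => m; rewrite /series/= !fctE mulr_suml -sumrB.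
  by apply: eq_bigr => i _; rewrite /excess; ring.
apply: cvgB; first exact: cvg_series_tail_random_sum.
exact: cvgMr_tmp.
Qed.

End random_sum_tail.

(** * From the second order relation to random sums *)

Section second_order_powers.
Context {R : realType}.
Variable F : probability R R.
Hypothesis F0 : supported_nonneg F.
Hypothesis long : forall t : R, 0 < t -> local_long_tailed t F.
Hypothesis Foo : (mean F < +oo)%E.

Local Notation D x := (incr F x (x + 1)).
Local Notation mu := (fine (mean F)).

Let D_gt0 : \forall x \near +oo, 0 < D x.
Proof. exact: incr_gt0_near. Qed.

Hypothesis incr2 :
  incr (convolution_pow F 2) x (x + 1) / D x @[x --> +oo] --> (2 : R).

Lemma cvg_bulk_incr (A : R) : 0 <= A ->
  bulk F A (fun u => D u) x / D x @[x --> +oo] -->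
  1 + (trunc_mean (convolution_pow F 1) (A + 1) -
       trunc_mean (convolution_pow F 1) A).
Proof.
move=> A0; have A1 : 0 <= A + 1 by lra.
have c1 := cvg_strip long (H := convolution_pow F 1) A0.
have c2 := cvg_comp _ _ (cvg_shift_pinfty 1) (cvg_strip long (H := convolution_pow F 1) A1).
have c3 : D (x + 1) / D x @[x --> +oo] --> (1 : R).
  by apply: (cvg_incr_shiftr long) => //; rewrite ler01 lexx.
rewrite (_ : 1 + _ = 2 - 1 - trunc_mean (convolution_pow F 1) A +
  trunc_mean (convolution_pow F 1) (A + 1) * 1); last by ring.
apply: cvg_trans (cvgD (cvgB (cvgB incr2 (cvg_cst (1 : R))) c1) (cvgM c2 c3)).
apply: near_eq_cvg.
apply: filterS2 D_gt0 (near_shift_pinfty 1 D_gt0) => x Dx Dx1 /=.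
rewrite !fctE/= bulk_incr//; field.
by rewrite !gt_eqF.
Qed.

(** Both truncated means converge to the mean of F. *)
Lemma cvg_trunc_gap :
  trunc_mean (convolution_pow F 1) (A + 1) - trunc_mean (convolution_pow F 1) A
    @[A --> +oo] --> (0 : R).
Proof.
have c := @cvg_trunc_mean_pow _ F 1 F0 Foo.
rewrite -[X in _ --> X](subrr (1%:R * mu)).
by apply: cvgB => //; exact: (cvg_comp _ _ (cvg_shift_pinfty 1) c).
Qed.

(** Local subexponentiality makes this premise of [excess_step] available for
    constants of either sign. *)
Lemma bulk_incr_mid (c e : R) : 0 < e ->
  \forall A \near +oo, \forall x \near +oo,
    c - e <= c * (bulk F A (fun u => D u) x / D x).
Proof.
move=> e0; have e2 : 0 < e / 2 by lra.
have : c * (1 + (trunc_mean (convolution_pow F 1) (A + 1) -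
       trunc_mean (convolution_pow F 1) A)) @[A --> +oo] --> c.
  rewrite -[X in _ --> X]mulr1; apply: cvgMl_tmp; rewrite -[X in _ --> X]addr0.
  by apply: cvgD; [exact: cvg_cst|exact: cvg_trunc_gap].
move=> /cvgrPdist_le/(_ _ e2); apply: filterS2 (near_pinfty_ge 0) => A A0 hA.
have cb : c * (bulk F A (fun u => D u) x / D x) @[x --> +oo] --> c * (1 +
    (trunc_mean (convolution_pow F 1) (A + 1) - trunc_mean (convolution_pow F 1) A)).
  by apply: cvgMl_tmp; exact: cvg_bulk_incr.
move/cvgrPdist_le/(_ _ e2) : cb.
apply: filterS => x; move: hA; rewrite !ler_norml => /andP[? ?] /andP[? ?].
lra.
Qed.

Hypothesis rel2 : excess F 2 x / D x @[x --> +oo] --> 2 * mu.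

Lemma excess_cvg n :
  excess F n x / D x @[x --> +oo] --> n%:R * (n%:R - 1) * mu.
Proof.
elim: n => [|n ih].
  rewrite !mul0r; apply: cvg_near_cst.
  by apply: filterS (near_pinfty_ge 0) => x x0; rewrite excess0// mul0r.
have step : (excess F n.+1 x - n%:R * excess F 2 x) / D x @[x --> +oo] -->
    n%:R * (n%:R - 1) * mu.
  have mid (c : R) : forall e, 0 < e -> exists c', [/\ c - e <= c', c' < c &
     \forall A \near +oo, \forall x \near +oo,
       c' - e <= c' * (bulk F A (fun u => D u) x / D x)].
    move=> e e0; exists (c - e / 2); split; [lra|lra|].
    exact: bulk_incr_mid.
  apply: asy_ge_cvg.
    have := @excess_step _ F F0 long Foo 1 _ n _ (mid _).
    move=> /(_ (n%:R * (n%:R - 1) * mu)) H.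
    under eq_fun do rewrite -[X in X / _]mul1r.
    apply: H; under eq_fun do rewrite mul1r.
    exact: cvg_asy_ge.
  have := @excess_step _ F F0 long Foo (-1) _ n _ (mid _).
  move=> /(_ (- (n%:R * (n%:R - 1) * mu))) H.
  under eq_fun do rewrite -mulNr -[X in X / _]mulN1r.
  apply: H; under eq_fun do rewrite mulN1r mulNr.
  by apply: cvg_asy_ge; exact: cvgN.
rewrite (_ : n.+1%:R * (n.+1%:R - 1) * mu =
  n%:R * (2 * mu) + n%:R * (n%:R - 1) * mu); last by rewrite -natr1; ring.
apply: cvg_trans (cvgD (cvgMl_tmp (a := n%:R) rel2) step).
apply: near_eq_cvg; apply: nearW => x.
by rewrite !fctE; ring.
Qed.

(** Far out D is positive and loses at most half of its value over a unit step,
    so it is bounded away from 0 on compact intervals. *)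
Lemma incr_lower_bound :
  \forall x \near +oo, forall L : nat, exists2 c : R, 0 < c &
    forall z, 0 <= z <= L%:R -> c <= D (x + z).
Proof.
have [_ /(_ (1 / 2)) h] := long ltr01.
have {h} := filterI D_gt0 (h ltac:(lra)) => -[M [Mr hM]].
exists M; split => // x xM.
elim=> [|L [c c0 ih]].
  exists (D x) => [|z]; first by have [] := hM x xM.
  by case/andP => ? ?; rewrite (_ : z = 0) ?addr0//; lra.
exists (c / 2) => [|z /andP[z0 zL]]; first by lra.
have [zL'|zL'] := leP z L%:R.
  by have := ih z; rewrite z0 zL' => /(_ isT); lra.
have [/= Du hu] := hM (x + L%:R) ltac:(rewrite (lt_le_trans xM)// lerDl//).
have := hu (z - L%:R); rewrite /= in_itv/= => /(_ _)/=.
have zz : 0 <= z - L%:R <= 1.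
  by move: zL; rewrite -natr1 => ?; apply/andP; split; lra.
move=> /(_ zz); rewrite (_ : x + L%:R + (z - L%:R) = x + z); last by ring.
rewrite ltr_norml => /andP[+ _]; rewrite ltrBrDr ltr_pdivlMr// => h.
have := ih L%:R; rewrite ler0n lexx => /(_ isT); lra.
Qed.

(** Passing from n to n+1 multiplies the bound by the ratio of the bulk of D to
    D, which is at most 1 + r once the cut is large, and adds a multiple of n+1
    from R_2 and the strips; C n^2 (1+r)^n solves this recursion. *)
Lemma excess_bound (r : R) : 0 < r -> exists2 C : R, 0 <= C &
  \forall x \near +oo, forall n,
    `|excess F n x| <= C * n%:R ^+ 2 * (1 + r) ^+ n * D x.
Proof.
move=> r0; have r2 : 0 < r / 2 by lra.
have [A [A0 hA]] : exists A : R, 0 <= A /\ \forall x \near +oo,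
    bulk F A (fun u => D u) x / D x <= 1 + r.
  have /cvgrPdist_le/(_ _ r2) H := cvg_trunc_gap.
  have [A [A0 hA]] := filter_ex (filterI (near_pinfty_ge 0) H).
  exists A; split => //; have /cvgrPdist_le/(_ _ r2) := cvg_bulk_incr A0.
  apply: filterS => x; move: hA; rewrite !ler_norml => /andP[? ?] /andP[? ?].
  lra.
have h2 : \forall x \near +oo, `|excess F 2 x| <= (2 * mu + 1) * D x.
  have /cvgrPdist_le/(_ _ ltr01) := rel2.
  have : 0 <= 2 * mu.
    by rewrite mulr_ge0// fine_ge0//; apply: mean_ge0.
  move=> mu0; apply: filterS2 D_gt0 => x Dx.
  rewrite ler_norml => /andP[a b].
  rewrite -ler_pdivrMr// -{1}(gtr0_norm Dx) -normf_div ler_norml.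
  by apply/andP; split; lra.
pose good x := [/\ 0 < D x, bulk F A (fun u => D u) x / D x <= 1 + r,
  `|excess F 2 x| <= (2 * mu + 1) * D x, A <= x & 0 <= x].
have [M [_ hM]] : \forall x \near +oo, good x /\ forall L : nat, exists2 c : R, 0 < c &
    forall z, 0 <= z <= L%:R -> c <= D (x + z).
  near=> x; split; last by near: x; exact: incr_lower_bound.
  by split; near: x => //; exact: near_pinfty_ge.
(* From x1 on everything holds; x1 serves both as the cut and as the threshold,
   so that the bulk only sees the range where the induction hypothesis applies. *)
pose x1 := M + 1.
have x1M x : x1 <= x -> M < x by rewrite /x1; lra.
have gd x : x1 <= x -> good x by move=> /x1M/hM[].
have x10 : 0 <= x1 by have [] := gd x1 (lexx _).
have [C' C'0 hC'] : exists2 C' : R, 0 <= C' & forall x, x1 <= x ->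
    incr F (x - x1) x <= C' * D x.
  have := incr_uniform long x10 ltr01 => -[M2 [_ hM2]].
  (* Beyond x1 + L the uniform approximation bounds the strip; before that, the
     probability is at most 1 and D is bounded below. *)
  pose L := (Num.truncn (`|M2| + 1)).+1.
  have [_ /(_ L)[c c0 hc]] := hM x1 (x1M _ (lexx _)).
  have x1c : 0 <= x1 + 1 + c^-1 by rewrite addr_ge0 ?invr_ge0 ?ltW//; lra.
  exists (x1 + 1 + c^-1) => // x xx1.
  have [Dx _ _ _ _] := gd x xx1.
  have [xL|xL] := leP (x - x1) L%:R.
    have cD : c <= D x.
      have := hc (x - x1); rewrite subrKC; apply.
      by rewrite subr_ge0 xx1.
    apply: (@le_trans _ _ (c^-1 * D x)).
      rewrite ler_pdivlMl//.
      apply: (le_trans _ cD); rewrite -[X in _ <= X]mulr1 ler_pM2l//.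
      by rewrite incrE (le_trans _ (tail_le1 F (x - x1)))// gerBl tail_ge0.
    by rewrite ler_pM2r//; lra.
  have M2x : M2 < x.
    have := ler_norm M2; have := truncnS_gt (`|M2| + 1); rewrite -/L; lra.
  have := hM2 x M2x x1; rewrite x10 lexx => /(_ isT).
  rewrite ler_norml => /andP[_ h].
  have : 0 <= c^-1 * D x by rewrite mulr_ge0 ?invr_ge0 ?ltW.
  lra.
pose C := 2 * mu + 1 + C'.
have mu0 : 0 <= mu by rewrite fine_ge0//; apply: mean_ge0.
have C0 : 0 <= C by rewrite /C; lra.
exists C => //; exists x1; split; first exact: num_real.
move=> x /ltW xx1 n; elim: n x xx1 => [|n ih] x xx1.
  have [Dx _ _ _ x0] := gd x xx1.
  rewrite excess0// normr0 expr0 mulr1; apply: mulr_ge0 (ltW Dx).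
  by apply: mulr_ge0 => //; exact: sqr_ge0.
have [Dx bx e2x Ax x0] := gd x xx1.
have bD := bounded_measurable_incr F 1.
have be := bounded_measurable_excess F n.
pose a := C * n%:R ^+ 2 * (1 + r) ^+ n.
have a0 : 0 <= a.
  by rewrite /a !mulr_ge0// ?exprn_ge0//; lra.
rewrite (excess_rec F0 n x x10).
have k1 : `|bulk F x1 (excess F n) x| <= a * ((1 + r) * D x).
  have k2 : bulk F x1 (fun u => D u) x <= (1 + r) * D x.
    rewrite -ler_pdivrMr//; apply: le_trans bx; rewrite ler_pM2r ?invr_gt0//.
    apply: le_Rintegral => //.
    - by apply: bounded_measurable_integrable; exact: (bounded_measurable_bulk x1 x bD).
    - by apply: bounded_measurable_integrable; exact: (bounded_measurable_bulk A x bD).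
    move=> y _; apply: ler_wpM2r; first by rewrite incr_ge0// lerDl.
    rewrite !indicE !mem_setE !in_itv/= ler_nat.
    have : A <= x1 by have [] := gd x1 (lexx _).
    by case: (leP y (x - x1)) => //= ? ?; rewrite (_ : y <= x - A)//; lra.
  apply: (@le_trans _ _ (a * bulk F x1 (fun u => D u) x)); last exact: ler_wpM2l.
  rewrite ler_norml -mulNr -!bulkZ//; apply/andP; split; apply: le_bulk => //;
    try exact: bounded_measurableZ.
  - by move=> u /ih; rewrite -/a ler_norml mulNr => /andP[].
  - by move=> u /ih; rewrite -/a ler_norml => /andP[].
have k3 : `|strip F (convolution_pow F n) x1 x - n%:R * strip F (convolution_pow F 1) x1 x|
    <= n.+1%:R * (C' * D x).
  apply: le_trans (ler_normB _ _) _; rewrite normrM normr_nat.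
  rewrite !ger0_norm ?strip_ge0// -natr1 mulrDl mul1r addrC lerD//.
    apply: ler_wpM2l => //; exact: le_trans (strip_le _ _ _ x10) (hC' _ xx1).
  exact: le_trans (strip_le _ _ _ x10) (hC' _ xx1).
apply: le_trans (ler_normD _ _) _; apply: le_trans (lerD (ler_normD _ _) (lexx _)) _.
apply: le_trans (lerD (lerD (lexx _) k1) k3) _.
rewrite normrM normr_nat.
apply: (@le_trans _ _ (n%:R * ((2 * mu + 1) * D x) + a * ((1 + r) * D x)
  + n.+1%:R * (C' * D x))).
  by rewrite !lerD2r ler_wpM2l.
have r1 : 1 <= (1 + r) ^+ n.+1 by rewrite exprn_ege1//; lra.
rewrite /a [(1 + r) ^+ n.+1]exprS; rewrite exprS in r1.
set E := (1 + r) ^+ n in r1 *.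
have n1 : n.+1%:R = n%:R + 1 :> R by rewrite natr1.
have n0 : 0 <= n%:R :> R by [].
rewrite n1; set m : R := n%:R in n0 *.
have l1 : m * (2 * mu + 1) + (m + 1) * C' <= C * (2 * m + 1).
  have : 0 <= m * (2 * mu + 1) by rewrite mulr_ge0//; lra.
  have : 0 <= m * C' by rewrite mulr_ge0.
  by rewrite /C; lra.
have l2 : C * (2 * m + 1) <= C * (2 * m + 1) * ((1 + r) * E).
  by rewrite ler_peMr// mulr_ge0//; lra.
have := le_trans l1 l2; rewrite -(ler_pM2r Dx) => l3.
have -> : C * (m + 1) ^+ 2 * ((1 + r) * E) * D x =
  C * (2 * m + 1) * ((1 + r) * E) * D x + C * m ^+ 2 * E * ((1 + r) * D x) by ring.
have -> : m * ((2 * mu + 1) * D x) + C * m ^+ 2 * E * ((1 + r) * D x) + (m + 1) * (C' * D x)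
  = (m * (2 * mu + 1) + (m + 1) * C') * D x + C * m ^+ 2 * E * ((1 + r) * D x) by ring.
by rewrite lerD2r.
Unshelve. all: by end_near. Qed.

End second_order_powers.

Section series_helpers.
Context {R : realType}.

Lemma cvg_series_scale (k l : R) (u w : nat -> R) :
  (forall n, u n = k * w n) -> series w @ \oo --> l -> series u @ \oo --> k * l.
Proof.
move=> uw wl.
rewrite (_ : series u = (fun m => k * series w m)); first exact: cvgMl_tmp.
by apply/funext => m; rewrite /series/= mulr_sumr; apply: eq_bigr.
Qed.

Lemma cvg_series_single (a : R) l :
  series (fun n => if n == l then a else 0) @ \oo --> a.
Proof.
apply: cvg_near_cst; near=> m.
have lm : (l < m)%N by near: m; exact: nbhs_infty_gt.
rewrite seriesEord/= -big_mkcond/=.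
by rewrite (big_ord1_eq _ (fun=> a)) lm.
Unshelve. all: by end_near. Qed.

(** If (1 + r)^3 <= z then Bernoulli's inequality, used twice, absorbs n^2. *)
Lemma sqr_expr_le_geometric (z : R) : 1 < z ->
  exists r K : R, [/\ 0 < r, 0 <= K &
    forall n, n%:R ^+ 2 * (1 + r) ^+ n <= K * z ^+ n].
Proof.
move=> z1; pose r := Num.min 1 ((z - 1) / 7).
have r0 : 0 < r by rewrite lt_min ltr01/=; lra.
have r1 : r <= 1 by rewrite ge_min lexx.
have rz : r <= (z - 1) / 7 by rewrite ge_min lexx orbT.
clearbody r; exists r, (r^-1 ^+ 2); split => //; first exact: sqr_ge0.
have bern n : n%:R * r <= (1 + r) ^+ n.
  suff : 1 + n%:R * r <= (1 + r) ^+ n by lra.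
  elim: n => [|n ih]; first by rewrite mul0r addr0 expr0.
  rewrite exprS -natr1.
  have : (1 + r) * (1 + n%:R * r) <= (1 + r) * (1 + r) ^+ n.
    by apply: ler_wpM2l => //; lra.
  have : 0 <= n%:R * r * r by rewrite !mulr_ge0// ltW.
  lra.
have cube : (1 + r) ^+ 3 <= z.
  have : 0 <= r * (1 - r) by apply: mulr_ge0; lra.
  have : 0 <= r * r * (1 - r) by apply: mulr_ge0; [apply: mulr_ge0|]; lra.
  lra.
move=> n; set E := (1 + r) ^+ n.
have E0 : 0 <= E by rewrite exprn_ge0//; lra.
have nE : n%:R <= r^-1 * E by rewrite ler_pdivlMl// mulrC bern.
have n0 : 0 <= n%:R :> R by [].
apply: (@le_trans _ _ (r^-1 ^+ 2 * E ^+ 3)).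
  rewrite (_ : r^-1 ^+ 2 * E ^+ 3 = (r^-1 * E) ^+ 2 * E); last by ring.
  by apply: ler_wpM2r => //; rewrite ler_pXn2r// nnegrE (le_trans n0).
apply: ler_wpM2l; first exact: sqr_ge0.
rewrite /E -exprM mulnC exprM.
by apply: lerXn2r => //; rewrite nnegrE ?exprn_ge0//; lra.
Qed.

End series_helpers.

Section random_sum_of_second_order.
Context d (T : measurableType d) (R : realType) (P : probability T R).
Variables (N : {RV P >-> nat}) (F : probability R R).
Local Notation p := (nat_pmf N).
Local Notation D x := (incr F x (x + 1)).

(** The bounds on R_n make - C n^2 (1+r)^n p_n a minorant of both s p_n R_n / D,
    s = 1 and s = -1, so that applying Fatou's lemma twice gives the limit. *)
Theorem second_order_relation_of_subexponential :
  second_order_subexponential F -> pgf_analytic_at1 p ->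
  second_order_relation N F.
Proof.
move=> [F0 Foo sub [D0 rel]] /nbhs_ballP[e /= e0 hz].
have long t : 0 < t -> local_long_tailed t F by move=> /sub[].
have [_ [_ incr2]] := sub 1 ltr01.
have z1 : 1 < 1 + e / 2 by rewrite ltrDl divr_gt0.
have cz : cvgn (series (fun n => p n * (1 + e / 2) ^+ n)).
  by apply: hz; rewrite /ball/= opprD addNKr normrN ger0_norm; lra.
have [r [K [r0 K0 rK]]] := sqr_expr_le_geometric z1.
have p0 n : 0 <= p n := nat_pmf_ge0 N n.
have r1 n : 1 <= (1 + r) ^+ n by rewrite exprn_ege1//; lra.
have cb : cvgn (series (fun n => p n * (n%:R ^+ 2 * (1 + r) ^+ n))).
  apply: (@series_le_cvg _ _ (fun n => K * (p n * (1 + e / 2) ^+ n))).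
  - by move=> n; rewrite !mulr_ge0 ?sqr_ge0// (le_trans ler01).
  - by move=> n; rewrite !mulr_ge0// exprn_ge0//; lra.
  - by move=> n; rewrite [X in _ <= X]mulrCA ler_wpM2l.
  - by apply/cvg_ex; eexists; exact: (cvg_series_scale (fun n => erefl)) cz.
have sq n : n%:R <= n%:R ^+ 2 :> R by rewrite -natrX ler_nat; case: n => // n; rewrite leq_pmulr.
have c1 : cvgn (series (fun n => n%:R * p n)).
  apply: series_le_cvg cb => n; first by rewrite mulr_ge0.
    by rewrite !mulr_ge0 ?sqr_ge0// (le_trans ler01).
  rewrite mulrC; apply: ler_wpM2l => //; apply: (le_trans (sq n)).
  by rewrite ler_peMr// sqr_ge0.
have nn n : 0 <= n%:R * (n%:R - 1) :> R.
  by case: n => [|n]; rewrite ?mul0r// mulr_ge0// -natr1 addrK.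
have c2 : cvgn (series (fun n => n%:R * (n%:R - 1) * p n)).
  apply: series_le_cvg cb => n; first by rewrite mulr_ge0.
    by rewrite !mulr_ge0 ?sqr_ge0// (le_trans ler01).
  rewrite mulrC; apply: ler_wpM2l => //.
  apply: (@le_trans _ _ (n%:R ^+ 2)); last by rewrite ler_peMr// sqr_ge0.
  have := sq n; have : 0 <= n%:R :> R by []; rewrite expr2; lra.
split => //; split => //.
have [C C0 hC] := excess_bound F0 long Foo incr2 rel r0.
have Dpos := incr_gt0_near long ltr01.
have key (s : R) : `|s| = 1 -> asy_ge (fun x => s * ((tail (random_sum N F) x -
    limn (series (fun n => n%:R * p n)) * tail F x) / D x))
    (s * (fine (mean F) * limn (series (fun n => n%:R * (n%:R - 1) * p n)))).
  move=> s1.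
  have cs x : series (fun n => p n * (s * (excess F n x / D x))) @ \oo -->
      s * ((tail (random_sum N F) x -
    limn (series (fun n => n%:R * p n)) * tail F x) / D x).
    rewrite [X in _ --> X]mulrCA.
    rewrite (_ : _ * (s / D x) = s / D x * (tail (random_sum N F) x -
      limn (series (fun n => n%:R * p n)) * tail F x)); last by ring.
    apply: cvg_series_scale (cvg_series_excess c1) => n; ring.
  have cl : series (fun n => p n * (s * (n%:R * (n%:R - 1) * fine (mean F)))) @ \oo -->
    s * (fine (mean F) * limn (series (fun n => n%:R * (n%:R - 1) * p n))).
    rewrite mulrA; apply: cvg_series_scale c2 => n; ring.
  apply: (@series_liminf _ (fun x n => p n * (s * (excess F n x / D x)))
    _ (fun n => C * (p n * (n%:R ^+ 2 * (1 + r) ^+ n))) _ _ _ _ _ _ cl cs).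
  - move=> n; apply: asy_geZ => //; apply: cvg_asy_ge; apply: cvgMl_tmp.
    exact: excess_cvg.
  - by move=> n; rewrite !mulr_ge0 ?sqr_ge0// (le_trans ler01).
  - apply: filterS2 Dpos hC => x Dx hx n.
    rewrite lerNl -mulrN [X in _ <= X]mulrCA; apply: ler_wpM2l => //.
    apply: le_trans (ler_norm _) _; rewrite normrN !normrM s1 mul1r normfV.
    rewrite (gtr0_norm Dx) ler_pdivrMr// mulrA; exact: hx.
  - by apply/cvg_ex; eexists; exact: (cvg_series_scale (fun n => erefl)) cb.
apply: asy_ge_cvg.
  have := key 1 (normr1 _); rewrite mul1r.
  by under eq_fun do rewrite mul1r.
have := key (-1) (normrN1 _); rewrite mulN1r.
by under eq_fun do rewrite mulN1r.
Qed.

End random_sum_of_second_order.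

(** * From random sums back to the second order relation *)

Section converse_excess.
Context {R : realType}.
Variable F : probability R R.
Hypothesis F0 : supported_nonneg F.
Hypothesis long : forall t : R, 0 < t -> local_long_tailed t F.
Hypothesis Foo : (mean F < +oo)%E.

Local Notation D x := (incr F x (x + 1)).
Local Notation mu := (fine (mean F)).

Let D_gt0 : \forall x \near +oo, 0 < D x.
Proof. exact: incr_gt0_near. Qed.

(** Markov's inequality at a point with positive tail. *)
Lemma mean_gt0_long : 0 < mu.
Proof.
have [A [Ap DA]] : exists A : R, 1 <= A /\ 0 < D A.
  by have [A []] := filter_ex (filterI (near_pinfty_ge 1) D_gt0); exists A.
have A0 : 0 <= A by lra.
have tA : 0 < tail F A.
  apply: lt_le_trans DA _; by rewrite incrE gerBl tail_ge0.
have cm := cvg_trunc_mean F0 Foo.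
have : A * tail F A <= mu.
  rewrite -(cvg_lim _ cm)//; apply: limr_ge; first by apply/cvg_ex; exists mu.
  near=> B.
  apply: (@le_trans _ _ (trunc_mean F A)); last first.
    by apply: trunc_mean_nondecreasing => //; near: B; exact: near_pinfty_ge.
  have bi : bounded_measurable (\1_(`]A, +oo[%classic) : R -> R).
    exact: bounded_measurable_indic.
  rewrite -Rintegral_indic_gt -RintegralZl//; last exact: bounded_measurable_integrable.
  apply: le_Rintegral => //.
  - by apply: bounded_measurable_integrable; exact: bounded_measurableZ.
  - by apply: bounded_measurable_integrable; exact: bounded_measurable_trunc.
  move=> y _; rewrite indicE mem_setE in_itv/= andbT.
  case: (ltP A y) => Ay; last by rewrite mulr0 trunc_ge0.
  by rewrite mulr1; apply: le_trans (min_le_trunc A y); rewrite min_r// ltW.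
by apply: lt_le_trans; rewrite mulr_gt0//; lra.
Unshelve. all: by end_near. Qed.

(** Bonferroni: on the half-line the sum exceeds x as soon as one of the
    independent summands does, and R_n is at least the negated probability that
    two of them do. *)
Lemma excess_ge n x : - (n%:R ^+ 2 * tail F x ^+ 2) <= excess F n x.
Proof.
set a := tail F x; have a0 : 0 <= a := tail_ge0 F x; have a1 : a <= 1 := tail_le1 F x.
elim: n => [|n ih].
  by rewrite /excess mul0r subr0 expr0n/= mul0r oppr0 tail_ge0.
have bt := bounded_measurable_tail (convolution_pow F n).
have step : a + tail (convolution_pow F n) x * (1 - a) <= tail (convolution_pow F n.+1) x.
  rewrite (@tail_powS _ F F0 n 0 x (lexx _)) -[X in _ <= X]addrA lerD2l.
  apply: le_trans (_ : _ <= bulk F 0 (tail (convolution_pow F n)) x) _; last first.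
    by rewrite lerDl strip_ge0.
  have bi : bounded_measurable (\1_(`]-oo, x]%classic) : R -> R).
    exact: bounded_measurable_indic.
  rewrite /a -Rintegral_indic_le -RintegralZl//; last exact: bounded_measurable_integrable.
  apply: (le_Rintegral_full (measurable_itv `[0, +oo[) F0).
  - exact: bounded_measurableZ.
  - exact: (bounded_measurable_bulk 0 x bt).
  move=> y /=; rewrite in_itv/= andbT => y0; rewrite subr0 mulrC.
  apply: ler_wpM2l; first by rewrite indicE.
  by rewrite tail_nonincreasing// gerBl.
move: ih; rewrite /excess -/a.
set t := tail (convolution_pow F n) x in step *.
rewrite -natr1; set m : R := n%:R; have m0 : 0 <= m by [].
have m0' : 0 <= m * a ^+ 2 by rewrite mulr_ge0// sqr_ge0.
have m1 : 0 <= (m ^+ 2 * a ^+ 2) * a by rewrite !mulr_ge0// sqr_ge0.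
have a2 : 0 <= a ^+ 2 by rewrite sqr_ge0.
have am : 0 <= 1 - a by lra.
move=> ih; have ih' : m * a - m ^+ 2 * a ^+ 2 <= t by lra.
have := ler_wpM2r am ih'; lra.
Qed.

Hypothesis sqr_tail : tail F x ^+ 2 / D x @[x --> +oo] --> (0 : R).

Lemma cvg_incr_back (A : R) : 0 <= A ->
  incr F (x - A) x / D x @[x --> +oo] --> A.
Proof.
move=> A0; apply/cvgrPdist_le => e e0.
apply: filterS2 D_gt0 (incr_uniform long A0 e0) => x Dx /(_ A).
rewrite A0 lexx => /(_ isT).
have di : 0 < (D x)^-1 by rewrite invr_gt0.
move=> /(ler_wpM2r (ltW di)); rewrite mulfK ?gt_eqF// -{1}(gtr0_norm di) -normrM.
by rewrite mulrBl mulfK ?gt_eqF// distrC.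
Qed.

(** The sum exceeds x if one summand lies in (x - A, x] and the other makes up for
    the difference. The two choices of the large summand give two strips with
    the same limit. The corrections are a tail value times another one or times
    the mass near x; all are o(D), because the squared tail is and because the
    tail vanishes at infinity. *)
Lemma excess2_liminf : asy_ge (fun x => excess F 2 x / D x) (2 * mu).
Proof.
have bt := bounded_measurable_tail F.
have lower A x : 0 <= A ->
    strip F (convolution_pow F 1) A x + strip F F A x
    - tail F (x - A) * incr F (x - A) x
    - (tail F x ^+ 2 + tail F x * incr F (x - A) x) <= excess F 2 x.
  move=> A0; rewrite /excess (tail_pow2 F0 x A0).
  suff : tail F x * (1 - tail F (x - A)) + strip F F A x -
      incr F (x - A) x * tail F (x - A) <= bulk F A (tail F) x.
    have -> : incr F (x - A) x = tail F (x - A) - tail F x by rewrite incrE.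
    lra.
  have b1 : bounded_measurable (\1_(`]-oo, x - A]%classic) : R -> R).
    exact: bounded_measurable_indic.
  have b2 : bounded_measurable (\1_(`]x - A, +oo[%classic) : R -> R).
    exact: bounded_measurable_indic.
  have b3 := bounded_measurable_incr_trunc F x A0.
  have b1' := bounded_measurableZ (tail F x) b1.
  have b2' := bounded_measurableZ (incr F (x - A) x) b2.
  rewrite -Rintegral_indic_le -[X in _ - _ * X]Rintegral_indic_gt.
  rewrite -!RintegralZl//; [|exact: bounded_measurable_integrable..].
  rewrite -RintegralD//; [|exact: bounded_measurable_integrable..].
  rewrite -RintegralB//; last 2 first.
  - by apply: bounded_measurable_integrable; exact: bounded_measurableD.
  - exact: bounded_measurable_integrable.
  apply: (le_Rintegral_full (measurable_itv `[0, +oo[) F0).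
  - by apply: bounded_measurableB => //; exact: bounded_measurableD.
  - exact: (bounded_measurable_bulk A x bt).
  move=> y /=; rewrite in_itv/= andbT => y0.
  rewrite !indicE !mem_setE !in_itv/= andbT.
  case: (leP y (x - A)) => yA; rewrite /= ?(mulr0, mulr1, mul0r, mul1r, subr0, add0r).
    have : tail F (x - trunc A y) <= tail F (x - y).
      by rewrite tail_nonincreasing// lerB// /trunc ge_max y0 ge_min lexx.
    by rewrite incrE; lra.
  by rewrite subr_le0 !incrE lerB// tail_nonincreasing// lerB// trunc_le.
have lim A : 0 <= A -> asy_ge (fun x => excess F 2 x / D x)
    (trunc_mean (convolution_pow F 1) A + trunc_mean F A).
  move=> A0.
  have t1 := @tail_cvg0 _ F.
  have t2 := cvg_comp _ _ (cvg_shift_pinfty (- A)) t1.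
  have ci := cvg_incr_back A0.
  have c1 := cvg_strip long (H := convolution_pow F 1) A0.
  have c2 := cvg_strip long (H := F) A0.
  rewrite (_ : _ + _ = trunc_mean (convolution_pow F 1) A + trunc_mean F A - 0 * A
     - (0 + 0 * A)); last by ring.
  apply: asy_ge_near (cvg_asy_ge
    (cvgB (cvgB (cvgD c1 c2) (cvgM t2 ci)) (cvgD sqr_tail (cvgM t1 ci)))).
  apply: filterS D_gt0 => x Dx.
  rewrite !fctE/= !mulrA -!mulrDl -!mulrBl ler_pM2r ?invr_gt0//; exact: lower.
move=> e e0; have e2 : 0 < e / 2 by lra.
have : trunc_mean (convolution_pow F 1) A + trunc_mean F A @[A --> +oo] --> 2 * mu.
  rewrite (_ : 2 * mu = 1%:R * mu + mu); last by ring.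
  by apply: cvgD; [exact: cvg_trunc_mean_pow | exact: cvg_trunc_mean].
move=> /cvgrPdist_le/(_ _ e2)/(filterI (near_pinfty_ge 0))/filter_ex[A [A0 hA]].
apply: filterS (lim A A0 _ e2) => x.
move: hA; rewrite ler_norml => /andP[? ?]; lra.
Qed.

(** For n = 1 the bound is trivial and has constant 0. For n >= 2 the constant is
    positive, so the lower bound on the bulk of D suffices. *)
Lemma excess_step_liminf n : (0 < n)%N ->
  asy_ge (fun x => excess F n x / D x) (n%:R * (n%:R - 1) * mu) ->
  asy_ge (fun x => (excess F n.+1 x - n%:R * excess F 2 x) / D x)
    (n%:R * (n%:R - 1) * mu).
Proof.
case: n => // -[_ _ e e0|n _ h].
  apply: nearW => x; rewrite mul1r !subrr !(mulr0, mul0r); lra.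
set c := (_ * mu) in h *.
have c0 : 0 < c.
  by rewrite /c !mulr_gt0 ?mean_gt0_long// subr_gt0 ltr1n.
have := @excess_step _ F F0 long Foo 1 c n.+2.
under eq_fun do rewrite mul1r.
under [X in _ -> _ -> asy_ge X _]eq_fun do rewrite mul1r.
apply => // e e0.
pose c' := Num.max (c - e) (c / 2).
have c1 : c - e <= c' by rewrite le_max lexx.
have c2 : c / 2 <= c' by rewrite le_max lexx orbT.
have c3 : c' < c by rewrite gt_max; apply/andP; split; lra.
exists c'; split => //; apply: nearW => A.
have e1 : 0 < e / c' by rewrite divr_gt0//; lra.
apply: filterS (bulk_incr_ge F0 long A e1) => x hx.
have c'0 : 0 < c' by lra.
apply: le_trans (ler_wpM2l (ltW c'0) hx).
by rewrite mulrBr mulr1 mulrCA mulfV ?mulr1// gt_eqF.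
Qed.

Lemma excess_liminf n :
  asy_ge (fun x => excess F n x / D x) (n%:R * (n%:R - 1) * mu).
Proof.
elim: n => [|[|n] ih].
- rewrite !mul0r; apply: cvg_asy_ge; apply: cvg_near_cst.
  by apply: filterS (near_pinfty_ge 0) => x x0; rewrite excess0// mul0r.
- rewrite subrr mulr0 mul0r; apply: cvg_asy_ge; apply: cvg_near_cst; apply: nearW => x.
  by rewrite /excess tail_pow1 mul1r subrr mul0r.
have := asy_geD (asy_geZ (ler0n R n.+1) excess2_liminf) (excess_step_liminf (ltn0Sn n) ih).
have -> : n.+1%:R * (2 * mu) + n.+1%:R * (n.+1%:R - 1) * mu = n.+2%:R * (n.+2%:R - 1) * mu.
  by rewrite -[n.+2%:R]natr1; ring.
by apply: asy_ge_near; apply: nearW => x; rewrite le_eqVlt; apply/orP; left; apply/eqP; ring.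
Qed.

Lemma cvg_incr_shift (t : R) : 0 < t -> D x / D (x + t) @[x --> +oo] --> (1 : R).
Proof.
move=> t0; pose j := (Num.truncn t).+1; pose h := t / j%:R.
have j0 : 0 < j%:R :> R by [].
have h01 : 0 <= h <= 1.
  apply/andP; split; first by rewrite divr_ge0// ltW.
  by rewrite ler_pdivrMr// mul1r ltW// truncnS_gt.
have jh : j%:R * h = t by rewrite /h mulrC divfK// gt_eqF.
have := cvg_comp _ _ (cvg_shift_pinfty t) (cvg_incr_steps long j ltr01 h01).
apply: cvg_trans; apply: near_eq_cvg; apply: nearW => x /=.
by rewrite jh addrK.
Qed.

(** The increments of F^2 are differences of the excess, whose limit ratio does
    not depend on the shift. *)
Lemma local_subexponential_of_excess (t : R) : 0 < t ->
  excess F 2 x / D x @[x --> +oo] --> 2 * mu -> local_subexponential t F.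
Proof.
move=> t0 c2; split; first exact: long.
have [nz _] := long t0; split => //.
have c3 := cvg_comp _ _ (cvg_shift_pinfty t) c2.
have c1 := cvg_incr_shift t0.
have c4 := cvg_comp _ _ (cvg_shift_pinfty t) (cvg_incr_back (ltW t0)).
rewrite [X in _ --> X](_ : 2 = 2 + (2 * mu * 1 - 2 * mu) * t^-1); last by ring.
apply: cvg_trans (cvgD (cvg_cst (2 : R)) (cvgM (cvgB (cvgM c2 c1) c3)
  (cvgV (lt0r_neq0 t0) c4))).
apply: near_eq_cvg.
near=> x.
have Dx : 0 < D x by near: x.
have Dxt : 0 < D (x + t) by near: x; exact: (near_shift_pinfty t D_gt0).
have It : 0 < incr F x (x + t) by near: x; exact: incr_gt0_near.
rewrite !fctE/= addrK.
have -> : incr (convolution_pow F 2) x (x + t) =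
   2 * incr F x (x + t) + (excess F 2 x - excess F 2 (x + t)).
  rewrite /excess !incrE; move: (tail (convolution_pow F 2)) (tail F) => T2 T1.
  ring.
move: (excess F 2 x) (excess F 2 (x + t)) (incr F x (x + t)) It (D x) Dx
  (D (x + t)) Dxt => e1 e2 I I0 d d0 d' d'0.
by field; rewrite !gt_eqF.
Unshelve. all: by end_near. Qed.

End converse_excess.

Section converse.
Context d (T : measurableType d) (R : realType) (P : probability T R).
Variables (N : {RV P >-> nat}) (F : probability R R).
Local Notation p := (nat_pmf N).
Local Notation D x := (incr F x (x + 1)).
Local Notation mu := (fine (mean F)).

Hypothesis F0 : supported_nonneg F.
Hypothesis long : forall t : R, 0 < t -> local_long_tailed t F.
Hypothesis Foo : (mean F < +oo)%E.
Hypothesis sqr_tail : tail F x ^+ 2 / D x @[x --> +oo] --> (0 : R).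
Hypothesis rel : second_order_relation N F.

Let p0 n : 0 <= p n := nat_pmf_ge0 N n.

(** Fatou's lemma for the terms n <> l: these already use up their full share
    of the limit, so that nothing beyond its own share is left for n = l. *)
Lemma excess_limsup l : 0 < p l ->
  asy_ge (fun x => - (excess F l x / D x)) (- (l%:R * (l%:R - 1) * mu)).
Proof.
move=> pl; have [c1 c2 [_ cG]] := rel.
pose cl n := p n * (n%:R * (n%:R - 1) * mu).
pose u x n := p n * (excess F n x / D x).
pose single (w : nat -> R) n := if n == l then w l else 0.
have cs x : series (u x) @ \oo --> (tail (random_sum N F) x -
    limn (series (fun n => n%:R * p n)) * tail F x) / D x.
  rewrite [X in _ --> X]mulrC; apply: cvg_series_scale (cvg_series_excess c1) => n.
  by rewrite /u; ring.
have cc : series cl @ \oo --> mu * limn (series (fun n => n%:R * (n%:R - 1) * p n)).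
  by apply: cvg_series_scale c2 => n; rewrite /cl; ring.
have rest w : series (fun n => w n - single w n) = series w - series (single w).
  by apply/funext => m; rewrite /series/= !fctE sumrB.
have cb : cvgn (series (fun n => n%:R ^+ 2 * p n)).
  apply/cvg_ex; eexists.
  apply: cvg_trans (cvgD c2 c1); apply: near_eq_cvg; apply: nearW => m.
  by rewrite !fctE /series/= -big_split/=; apply: eq_bigr => n _; ring.
have Dpos := incr_gt0_near long ltr01.
have key : asy_ge (fun x => (tail (random_sum N F) x -
    limn (series (fun n => n%:R * p n)) * tail F x) / D x - u x l)
    (mu * limn (series (fun n => n%:R * (n%:R - 1) * p n)) - cl l).
  apply: (@series_liminf _ (fun x n => u x n - single (u x) n)
    (fun n => cl n - single cl n) (fun n => n%:R ^+ 2 * p n)).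
  - move=> n; rewrite /single; case: eqP => [->|_].
      by rewrite !subrr => e e0; apply: nearW => x; rewrite subrr; lra.
    rewrite subr0; under eq_fun do rewrite subr0.
    by apply: asy_geZ => //; exact: excess_liminf.
  - by move=> n; rewrite mulr_ge0// sqr_ge0.
  - have /cvgrPdist_le/(_ _ ltr01) := sqr_tail; apply: filterS2 Dpos => x Dx.
    rewrite sub0r normrN => hx n.
    have b0 : 0 <= n%:R ^+ 2 * p n by rewrite mulr_ge0// sqr_ge0.
    rewrite /single; case: eqP => [->|_]; first by rewrite subrr lerNl oppr0 mulr_ge0// sqr_ge0.
    rewrite subr0 /u [X in - X]mulrC -mulrN; apply: ler_wpM2l => //.
    rewrite ler_pdivlMr//; apply: le_trans (excess_ge F0 n x).
    rewrite mulNr lerN2; apply: ler_wpM2l; first exact: sqr_ge0.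
    by rewrite -[X in _ <= X]mul1r -ler_pdivrMr//; exact: le_trans (ler_norm _) hx.
  - exact: cb.
  - by rewrite rest; apply: cvgB => //; exact: cvg_series_single.
  - by move=> x; rewrite rest; apply: cvgB => //; exact: cvg_series_single.
set g := fun x => _ / D x in cG cs; set L := mu * _ in cG key.
have cN : asy_ge (fun x => - g x) (- L) by apply: cvg_asy_ge; exact: cvgN.
have pi : 0 <= (p l)^-1 by rewrite invr_ge0.
have := asy_geZ pi (asy_geD key cN).
have -> : L - cl l - L = p l * - (l%:R * (l%:R - 1) * mu) by rewrite /cl; ring.
rewrite mulKf ?gt_eqF//; apply: asy_ge_near; apply: nearW => x.
rewrite -/(g x) (_ : g x - u x l - g x = p l * - (excess F l x / D x)).
  by rewrite mulKf ?gt_eqF.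
by rewrite /u; ring.
Qed.

(** The recursion from l-1 to l, with R_l bounded above and the remainder
    R_l - (l-1) R_2 bounded below, bounds R_2 from above. *)
Theorem subexponential_of_second_order_relation :
  (exists l : nat, (2 <= l)%N /\ 0 < p l) -> second_order_subexponential F.
Proof.
move=> [[|[|n]] [// _ pl]].
have [Dnz _] := long ltr01.
have lim2 : excess F 2 x / D x @[x --> +oo] --> 2 * mu.
  apply: asy_ge_cvg; first exact: excess2_liminf.
  have := asy_geD (excess_step_liminf F0 long Foo (ltn0Sn n)
    (excess_liminf F0 long Foo sqr_tail n.+1)) (excess_limsup pl).
  have -> : n.+1%:R * (n.+1%:R - 1) * mu + - (n.+2%:R * (n.+2%:R - 1) * mu) =
      n.+1%:R * - (2 * mu) by rewrite -[n.+2%:R]natr1; ring.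
  have ni : 0 <= n.+1%:R^-1 :> R by rewrite invr_ge0.
  move=> /(asy_geZ ni); rewrite mulKf ?pnatr_eq0//.
  apply: asy_ge_near; apply: nearW => x.
  have -> : (excess F n.+2 x - n.+1%:R * excess F 2 x) / D x + - (excess F n.+2 x / D x) =
     n.+1%:R * - (excess F 2 x / D x) by ring.
  by rewrite mulKf ?pnatr_eq0.
split=> [//|//|t t0|]; first exact: local_subexponential_of_excess.
by split; [exact: Dnz | exact: lim2].
Qed.

End converse.

Theorem theorem1 (d : measure_display) (Omega : measurableType d)
    (R : realType) (P : probability Omega R) (N : {RV P >-> nat})
    (F : probability R R) (F_ge0 : supported_nonneg F) :
  (second_order_subexponential F -> pgf_analytic_at1 (nat_pmf N) ->
     second_order_relation N F)
  /\
  ((forall t : R, 0 < t -> local_long_tailed t F) ->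
   (mean F < +oo)%E ->
   sim_cst (fun x => tail F x ^+ 2) 0 (fun x => incr F x (x + 1)) ->
   second_order_relation N F ->
   (exists l : nat, (2 <= l)%N /\ 0 < nat_pmf N l) ->
   second_order_subexponential F).
Proof.
split; first exact: second_order_relation_of_subexponential.
move=> long Foo [_ sqr_tail] rel.
exact: subexponential_of_second_order_relation.
Qed.
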